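(* Let $G$ and $H$ be two finite simple graphs with disjoint vertex sets, and let $G*H$ be their product. Then $$\mathrm{reg}(R/I(G*H))=\max\{\mathrm{reg}(R/I(G)),\mathrm{reg}(R/I(H))\}.$$
   Context: $\mathbb{K}$ is a field. For a finite simple graph $G$ with vertex set $V(G)=\{x_1,\dots,x_n\}$ and edge set $E(G)$, the edge ideal $I(G)$ is the ideal generated by the monomials $x_ix_j$ with $\{x_i,x_j\}\in E(G)$ in the polynomial ring $R$ over $\mathbb{K}$ whose variables are the vertices of the graph in question. For a finitely generated graded $R$-module $M$ with graded Betti numbers $\beta_{i,j}(M)$ (from the minimal graded free resolution), the Castelnuovo-Mumford regularity is $\mathrm{reg}(M)=\max\{j-i \mid \beta_{i,j}(M)\neq 0\}$. For graphs $G,H$ with $V(G)\cap V(H)=\emptyset$, the product $G*H$ is the graph on $V(G)\cup V(H)$ with edge set $E(G)\cup E(H)\cup\{\{x,y\}\mid x\in V(G),\ y\in V(H)\}$.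
   Formalization: The formal theorem also assumes that G or H has an edge, or that one vertex set is empty; if both graphs are edgeless and nonempty, G*H is complete bipartite, its regularity is 1, the maximum is 0, and the equality fails. *)

(* Defs.v *)
From HB Require Import structures.
From mathcomp Require Import all_boot all_order all_algebra.
From mathcomp Require Import mpoly.
From Stdlib Require Import ClassicalEpsilon.

Set Implicit Arguments.
Unset Strict Implicit.
Unset Printing Implicit Defensive.

Import Order.TTheory GRing.Theory Num.Theory.
Local Open Scope ring_scope.

Record sgraph := SGraph {
  vertex :> finType;
  edge : rel vertex;
  edge_sym : ssrbool.symmetric edge;
  edge_irrefl : irreflexive edge }.

Section GraphProduct.
Variables G H : sgraph.

(* The sum type is the disjoint union of the two vertex sets. *)
Definition prod_edge (a b : G + H) : bool :=
  match a, b with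
  | inl x, inl y => edge x y
  | inr x, inr y => edge x y
  | inl _, inr _ | inr _, inl _ => true
  end.

Lemma prod_edge_sym : ssrbool.symmetric prod_edge.
Proof. by case=> x [] y //=; apply: edge_sym. Qed.

Lemma prod_edge_irrefl : irreflexive prod_edge.
Proof. by case=> x /=; apply: edge_irrefl. Qed.

Definition graph_prod : sgraph := SGraph prod_edge_sym prod_edge_irrefl.
End GraphProduct.

Definition gen_ideal (R : comNzRingType) (S : R -> Prop) (p : R) : Prop :=
  exists (m : nat) (a s : 'I_m -> R),
    (forall i, S (s i)) /\ p = \sum_(i < m) a i * s i.

(* The vertex v is the variable of index enum_rank v. *)
Definition edge_ideal (K : fieldType) (G : sgraph) :
    {mpoly K[#|G|]} -> Prop :=
  gen_ideal (fun p => exists u v : G,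
    edge u v /\ p = 'X_(enum_rank u) * 'X_(enum_rank v)).

Section Regularity.
Variables (K : fieldType) (n : nat).
Local Notation R := {mpoly K[n]}.

Definition max_homog_ideal : R -> Prop :=
  gen_ideal (fun p => exists i : 'I_n, p = 'X_i).

(* The only homogeneous element of negative degree is 0. *)
Definition homog_of_deg (z : int) (p : R) : Prop :=
  p = 0 \/ exists d : nat, z = d%:Z /\ p \is d.-homog.

(* A sequence ... -> F_1 -> F_0 -> R of free modules with
   F_i = \bigoplus_(k < fr_rank i) R(- fr_deg k), elements being row vectors
   and maps acting by right multiplication. *)
Record free_seq := FreeSeq {
  fr_rank : nat -> nat;
  fr_deg : forall i, 'I_(fr_rank i) -> int;
  fr_aug : 'cV[R]_(fr_rank 0);
  fr_diff : forall i, 'M[R]_(fr_rank i.+1, fr_rank i) }.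

(* The augmentation F_0 -> R/I is given by a homogeneous lift fr_aug to
   F_0 -> R, which exists because F_0 is free; its surjectivity and its kernel
   are therefore expressed modulo I. *)
Record graded_free_resolution (I : R -> Prop) (F : free_seq) : Prop := {
  res_aug_homog : forall k, homog_of_deg (fr_deg k) (fr_aug F k ord0);
  res_diff_homog : forall i k l,
    homog_of_deg (fr_deg k - fr_deg l) (fr_diff F i k l);
  res_surj : forall p : R, exists v : 'rV[R]_(fr_rank F 0),
    I (p - (v *m fr_aug F) ord0 ord0);
  res_exact0 : forall v : 'rV[R]_(fr_rank F 0),
    I ((v *m fr_aug F) ord0 ord0) <-> exists w, v = w *m fr_diff F 0;
  res_exact : forall i (v : 'rV[R]_(fr_rank F i.+1)),
    v *m fr_diff F i = 0 <-> exists w, v = w *m fr_diff F i.+1 }.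

Definition minimal_resolution (I : R -> Prop) (F : free_seq) : Prop :=
  graded_free_resolution I F /\
  forall i k l, max_homog_ideal (fr_diff F i k l).

Definition free_seq0 : free_seq :=
  @FreeSeq (fun=> 0%N) (fun _ _ => 0) 0 (fun _ => 0).

(* For homogeneous I the minimal graded free resolution of R/I exists and is
   unique up to isomorphism, so the numbers below do not depend on the choice
   made here. *)
Definition min_res (I : R -> Prop) : free_seq :=
  epsilon (inhabits free_seq0) (minimal_resolution I).

(* The graded Betti number beta_(i,j)(R/I). *)
Definition betti (I : R -> Prop) (i : nat) (j : int) : nat :=
  #|[set k : 'I_(fr_rank (min_res I) i) | fr_deg k == j]|.

(* r is the maximum of the j - i with beta_(i,j)(R/I) nonzero. *)
Definition is_reg (I : R -> Prop) (r : int) : Prop :=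
  (exists (i : nat) (j : int), betti I i j <> 0%N /\ r = j - i%:Z) /\
  (forall (i : nat) (j : int), betti I i j <> 0%N -> j - i%:Z <= r).

(* reg(R/I), not reg(I).  The maximum exists for every proper homogeneous I,
   and only then is the value meaningful. *)
Definition reg_quot (I : R -> Prop) : int :=
  epsilon (inhabits 0) (is_reg I).

End Regularity.

(* Main.v *)
From HB Require Import structures.
Require Import Defs.
From mathcomp Require Import all_boot all_order all_algebra.
From mathcomp Require Import mpoly zify ring.
From Stdlib Require Import Classical ClassicalEpsilon.

Set Implicit Arguments.
Unset Strict Implicit.
Unset Printing Implicit Defensive.

Import Order.TTheory GRing.Theory Num.Theory.
Local Open Scope ring_scope.

(** The regularity of R/I is read off Koszul homology. For a minimal graded free
    resolution of R/I, a generator of degree j in homological degree i exists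
    exactly when the Koszul homology of R/I is nonzero in homological degree i
    and internal degree j ([resolution_degP]); this is the symmetry of Tor(R/I, K).
    An exterior monomial of degree i accounts for i of the internal degree, so
    t = j - i is the degree of the coefficients of a Koszul cycle, and the
    regularity is the largest t for which some cycle with coefficients of degree
    t does not bound ([reg_quot_le]). Minimal resolutions exist because
    polynomial rings are Noetherian: at every stage a generating set of least
    size is chosen ([exists_minimal_resolution]). The maximum exists because
    exterior powers above the number of variables vanish ([reg_quotP]).

    Let x be the vertices of G and y those of H, and let R be the polynomial ring
    on all of them. Put A = I(G) + (y) and B = I(H) + (x). Every mixed product xy
    is an edge of the join, hence I(G*H) = A /\ B ([join_idealP]), while A + B is
    the ideal m of all variables. The sequence
      0 -> R/I(G*H) -> R/A (+) R/B -> R/m -> 0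
    ends in a module concentrated in degree 0, whose Koszul homology therefore
    has t = 0. For t >= 2 the homology of R/I(G*H) thus vanishes exactly when
    those of R/A and R/B do, and for t = 1 it vanishes only if both do
    ([vanish_cap], [vanish_cap_left]). On chains this is just the splitting of
    each coefficient of positive degree into a part in A and a part in B.

    The quotient R/A is the quotient of the polynomial ring of G by I(G), with the
    variables y acting as zero. Such a variable adds to the Koszul complex a copy
    of itself shifted by one exterior degree, with the same t, so R/A and the
    quotient for G have the same regularity ([reg_pull_ideal]). This settles all
    bounds r >= 1. If one of the graphs has an edge, both sides of the equation
    are at least 1 ([reg_edge]), so these bounds determine them. If one of the
    graphs is empty, its regularity is 0 and I(G*H) is the ideal, A or B, of the
    other graph. *)

(** * Finite generation over Noetherian rings *)

Section FinitelyGenerated.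
Variables (A : comNzRingType) (M : lmodType A).

Definition submodule (N : M -> Prop) : Prop :=
  N 0 /\ forall a u v, N u -> N v -> N (a *: u + v).

Fixpoint lspan (s : seq M) (v : M) : Prop :=
  if s is x :: s' then exists a, lspan s' (v - a *: x) else v = 0.

Definition fin_gen (N : M -> Prop) : Prop :=
  exists s, forall v, N v <-> lspan s v.

Lemma lspan_lin s a u v : lspan s u -> lspan s v -> lspan s (a *: u + v).
Proof.
elim: s u v => [|x s IH] u v /=; first by move=> -> ->; rewrite scaler0 addr0.
move=> [b hb] [c hc]; exists (a * b + c).
have -> : a *: u + v - (a * b + c) *: x = a *: (u - b *: x) + (v - c *: x).
  by rewrite scalerDl scalerBr scalerA addrACA opprD.
exact: IH.
Qed.

Lemma lspan0 s : lspan s 0.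
Proof. by elim: s => //= x s IH; exists 0; rewrite scale0r subr0. Qed.

Lemma lspan_submod s : submodule (lspan s).
Proof. by split; [apply: lspan0 | move=> *; apply: lspan_lin]. Qed.

Lemma lspan_cons x s v : lspan s v -> lspan (x :: s) v.
Proof. by move=> h; exists 0; rewrite scale0r subr0. Qed.

Lemma mem_lspan s x : x \in s -> lspan s x.
Proof.
elim: s => // y s IH; rewrite inE => /orP[/eqP->|/IH]; last exact: lspan_cons.
by exists 1; rewrite scale1r subrr; apply: lspan0.
Qed.

Lemma submodD N u v : submodule N -> N u -> N v -> N (u + v).
Proof. by case=> _ h hu hv; have := h 1 _ _ hu hv; rewrite scale1r. Qed.

Lemma submodZ N a u : submodule N -> N u -> N (a *: u).
Proof. by case=> h0 h hu; have := h a _ _ hu h0; rewrite addr0. Qed.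

Lemma submodB N u v : submodule N -> N u -> N v -> N (u - v).
Proof. by move=> h hu hv; rewrite -scaleN1r; apply: submodD => //; apply: submodZ. Qed.

Lemma lspan_sub s N v :
  submodule N -> (forall x, x \in s -> N x) -> lspan s v -> N v.
Proof.
move=> hN; elim: s v => [|x s IH] v /= hs; first by move=> ->; case: hN.
move=> [a ha]; rewrite -(subrK (a *: x) v).
apply: submodD => //; first by apply: IH => // y ys; apply: hs; rewrite inE ys orbT.
by apply: submodZ => //; apply: hs; rewrite inE eqxx.
Qed.

Lemma fin_genP N s : submodule N -> (forall x, x \in s -> N x) ->
  (forall v, N v -> lspan s v) -> fin_gen N.
Proof. by move=> hN h1 h2; exists s => v; split; [exact: h2 | exact: lspan_sub]. Qed.
End FinitelyGenerated.

(** Preimages of generators of the image, together with generators of the part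
    in the kernel, generate. *)
Lemma fin_gen_ext (A : comNzRingType) (M M' : lmodType A)
    (f : {linear M -> M'}) (N : M -> Prop) :
  submodule N -> fin_gen (fun w => exists2 v, N v & f v = w) ->
  fin_gen (fun v => N v /\ f v = 0) -> fin_gen N.
Proof.
move=> hN [s hs] [t ht].
have [s' [hs'1 hs'2]] : exists s' : seq M, (forall x, x \in s' -> N x) /\
    (forall v, lspan s (f v) -> exists2 u, lspan s' u & f (v - u) = 0).
  have {hs} : forall x, x \in s -> exists2 v, N v & f v = x.
    by move=> x /mem_lspan /hs.
  elim: s => [|x s IH] hs.
    exists [::]; split=> // v /= fv; exists 0 => //.
    by rewrite subr0 fv.
  case: IH => [y ys|s' [h1 h2]]; first by apply: hs; rewrite inE ys orbT.
  have [v Nv fv] := hs x (mem_head _ _).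
  exists (v :: s'); split=> [y|w /= [a]].
    by rewrite inE => /orP[/eqP->|/h1].
  rewrite -fv -linearZ_LR -linearB => /h2 [u hu fu].
  exists (a *: v + u); first by exists a; rewrite addrC addKr.
  by rewrite opprD addrA.
have sub_cat1 s1 s2 (v : M) : lspan s1 v -> lspan (s1 ++ s2) v.
  by apply: lspan_sub => [|x xs]; [exact: lspan_submod | apply: mem_lspan; rewrite mem_cat xs].
have sub_cat2 s1 s2 (v : M) : lspan s2 v -> lspan (s1 ++ s2) v.
  by apply: lspan_sub => [|x xs]; [exact: lspan_submod | apply: mem_lspan; rewrite mem_cat xs orbT].
apply: (@fin_genP _ _ _ (s' ++ t)) => // [x|v Nv].
  rewrite mem_cat => /orP[/hs'1//|xt].
  by have /ht[] : lspan t x by apply: mem_lspan.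
have /hs'2 [u su fu] : lspan s (f v) by apply/hs; exists v.
rewrite -(subrK u v); apply: submodD; first exact: lspan_submod.
  apply: sub_cat2; apply/ht; split=> //; apply: submodB => //.
  exact: (lspan_sub hN hs'1).
exact: sub_cat1.
Qed.

Definition noetherian (A : comNzRingType) : Prop :=
  forall N : A^o -> Prop, submodule N -> fin_gen N.

Lemma submod_im (A : comNzRingType) (M M' : lmodType A)
    (f : {linear M -> M'}) N :
  submodule N -> submodule (fun w => exists2 v, N v & f v = w).
Proof.
move=> [N0 Nl]; split; first by exists 0; rewrite ?linear0.
move=> a _ _ [u Nu <-] [v Nv <-]; exists (a *: u + v); first exact: Nl.
exact: linearP.
Qed.

Lemma submod_ker (A : comNzRingType) (M M' : lmodType A)
    (f : {linear M -> M'}) N :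
  submodule N -> submodule (fun v => N v /\ f v = 0).
Proof.
move=> [N0 Nl]; split; first by rewrite linear0.
move=> a u v [Nu fu] [Nv fv]; split; first exact: Nl.
by rewrite linearP fu fv scaler0 addr0.
Qed.

Lemma fin_gen_ext1 (A : comNzRingType) (M : lmodType A)
    (f : {linear M -> A^o}) (N : M -> Prop) :
  noetherian A -> submodule N ->
  fin_gen (fun v => N v /\ f v = 0) -> fin_gen N.
Proof. by move=> nA hN; apply: fin_gen_ext => //; apply: nA; apply: submod_im. Qed.

Lemma fin_gen0 (A : comNzRingType) (M : lmodType A) (N : M -> Prop) :
  submodule N -> (forall v, N v -> v = 0) -> fin_gen N.
Proof. by move=> hN h; apply: (@fin_genP _ _ _ [::]). Qed.

Lemma fin_gen_eq (A : comNzRingType) (M : lmodType A) (N N' : M -> Prop) :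
  (forall v, N v <-> N' v) -> fin_gen N -> fin_gen N'.
Proof. by move=> e [s hs]; exists s => v; rewrite -e. Qed.

Section CoordForm.
Variables (A : comNzRingType) (r : nat) (k : 'I_r).
Definition coord_form (v : 'rV[A]_r) : A^o := v ord0 k.
Lemma coord_form_linear : linear coord_form.
Proof. by move=> a u v; rewrite /coord_form !mxE. Qed.
HB.instance Definition _ :=
  GRing.isLinear.Build A 'rV[A]_r A^o _ coord_form coord_form_linear.
End CoordForm.

(** One coordinate is split off at a time; its values form an ideal. *)
Lemma noetherian_rV (A : comNzRingType) r (N : 'rV[A]_r -> Prop) :
  noetherian A -> submodule N -> fin_gen N.
Proof.
move=> nA hN.
have main k : (k <= r)%N ->
    fin_gen (fun v => N v /\ forall i : 'I_r, (k <= i)%N -> v ord0 i = 0).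
  have sm l : submodule (fun v => N v /\
      forall i : 'I_r, (l <= i)%N -> v ord0 i = 0).
    case: hN => N0 Nl; split; first by split=> // i _; rewrite mxE.
    move=> a u v [Nu hu] [Nv hv]; split; first exact: Nl.
    by move=> i li; rewrite !mxE hu // hv // mulr0 addr0.
  elim: k => [_|k IH kr].
    apply: fin_gen0 => // v [_ h]; apply/rowP => i; rewrite mxE; exact: h.
  apply: (@fin_gen_ext1 _ _ (coord_form (Ordinal kr))) => //.
  apply: fin_gen_eq (IH (ltnW kr)) => v; split.
    move=> [Nv h]; split; last by apply: h => /=.
    by split=> // i ki; apply: h; apply: ltnW.
  move=> [[Nv h] hk]; split=> // i; rewrite leq_eqVlt => /orP[/eqP e|/h//].
  by rewrite -hk /coord_form; congr (v _ _); apply: val_inj.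
apply: fin_gen_eq (main r (leqnn r)) => v; split=> [[]//|Nv]; split=> // i.
by rewrite leqNgt ltn_ord.
Qed.

Section CoefForm.
Variables (A : comNzRingType) (k : nat).
Definition coef_form (p : {poly A}) : A^o := p`_k.
Lemma coef_form_linear : linear coef_form.
Proof. by move=> a u v; rewrite /coef_form coefD coefZ. Qed.
HB.instance Definition _ :=
  GRing.isLinear.Build A {poly A} A^o _ coef_form coef_form_linear.
End CoefForm.

(** Hilbert's basis theorem: the coefficients that occur as leading coefficients
    of members of the ideal form an ideal; members realizing its generators
    reduce every member of the ideal to one of bounded degree, and those form a
    finitely generated module over the coefficients. *)
Lemma noetherian_poly (A : comNzRingType) : noetherian A -> noetherian {poly A}.
Proof.
move=> nA N hN.
have [N0 Nl] := hN.
pose bounded d (p : {poly A}) := forall i, (d < i)%N -> p`_i = 0.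
pose L (a : A^o) := exists d (p : {poly A}), [/\ N p, bounded d p & p`_d = a].
have bX d e p : bounded d p -> bounded (e + d)%N ('X^e * p).
  by move=> b i ei; rewrite coefXnM; case: ifP => // _; apply: b; lia.
have hL : submodule L.
  split; first by exists 0%N, 0; split=> // [i _|]; rewrite coef0.
  move=> a b c [d [p [Np bp <-]]] [e [q [Nq bq <-]]].
  exists (e + d)%N, (a%:P * ('X^e * p) + 'X^d * q); split.
  - apply: (Nl); first exact: (@submodZ _ _ N 'X^e p).
    exact: (@submodZ _ _ N 'X^d q).
  - move=> i hi; rewrite coefD coefCM (bX _ _ _ bp) // (bX _ _ _ bq) ?mulr0 ?addr0 //; lia.
  - rewrite coefD coefCM !coefXnM !ltnNge leq_addl leq_addr /= addnK.
    by rewrite [(e + d)%N]addnC addnK.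
have [s hs] := nA _ hL.
(* From the largest degree D of the chosen members fs on, combinations of their
   monomial multiples realize every leading coefficient in every degree. *)
have [D [fs [Nfs Lfs]]] : exists D (fs : seq {poly A}^o),
    (forall f, f \in fs -> N f) /\ forall e a, (D <= e)%N -> lspan s a ->
      exists g, [/\ lspan fs g, bounded e g & g`_e = a].
  have {hs} : forall x, x \in s -> L x by move=> x /mem_lspan/hs.
  elim: s => [|x s IH] hs.
    by exists 0%N, [::]; split=> // e a _ /= ->; exists 0; split=> // [i _|]; rewrite coef0.
  case: IH => [y ys|D [fs [h1 h2]]]; first by apply: hs; rewrite inE ys orbT.
  have [d [p [Np bp pd]]] := hs x (mem_head _ _).
  exists (maxn D d), (p :: fs); split=> [f|e a].
    by rewrite inE => /orP[/eqP->|/h1].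
  rewrite geq_max => /andP[De de] /= [c /h2 -/(_ _ De)[g [gs bg ge]]].
  have bq : bounded e ('X^(e - d) * p) by have := bX _ (e - d)%N _ bp; rewrite subnK.
  exists (g + c%:P * ('X^(e - d) * p)); split.
  - exists (c%:P * 'X^(e - d)); rewrite mulrA addrK //.
  - by move=> i hi; rewrite coefD coefCM bg // bq // mulr0 addr0.
  - rewrite coefD ge coefCM coefXnM ifN; last by lia.
    by rewrite subKn // pd subrK.
have sm l : @submodule A {poly A} (fun p => N p /\ bounded l p).
  split; first by split=> // i _; rewrite coef0.
  move=> a u v [Nu bu] [Nv bv]; split.
    by rewrite -mul_polyC; apply: Nl.
  by move=> i hi; rewrite coefD coefZ bu // bv // mulr0 addr0.
have [t ht] : @fin_gen A {poly A} (fun p => N p /\ bounded D p).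
  elim: (D) => [|l IH]; last first.
    apply: (@fin_gen_ext1 _ _ (@coef_form A l.+1)) => //.
    apply: fin_gen_eq IH => p; split.
      move=> [Np b]; split; last exact: b.
      by split=> // i hi; apply: b; lia.
    move=> [[Np b] bl]; split=> // i; rewrite leq_eqVlt => /orP[/eqP<-//|/b//].
  apply: (@fin_gen_ext1 _ _ (@coef_form A 0)) => //.
  apply: fin_gen0 => [|p [[_ b] h]]; first exact: submod_ker.
  by apply/polyP=> -[|i]; rewrite coef0 //; apply: b.
have t_N x : x \in t -> N x by move=> /mem_lspan /ht[].
apply: (@fin_genP _ _ _ ((t : seq {poly A}^o) ++ fs)) => // [x|p Np].
  by rewrite mem_cat => /orP[/t_N//|/Nfs].
set T := _ ++ _; have smT := lspan_submod T.
have : forall n, (size p <= n + D.+1)%N -> lspan T p; last first.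
  by apply; apply: leq_addr.
have smTA : @submodule A {poly A} (lspan T).
  by split=> [|a u v]; [exact: smT.1 | rewrite -mul_polyC; exact: smT.2].
move=> n; elim: n p Np => [|n IH] p Np sp.
  have : lspan t p.
    apply/ht; split=> // i hi; apply: nth_default; exact: leq_trans hi.
  by apply: lspan_sub => // x xt; apply: mem_lspan; rewrite mem_cat xt.
have [||g [gfs bg ge]] := Lfs (n + D.+1)%N (p`_(n + D.+1)); first by lia.
  apply/hs; exists (n + D.+1)%N, p; split=> // i hi.
  by apply: nth_default; apply: leq_trans sp _.
rewrite -(subrK g p); apply: submodD => //.
  apply: IH; first by apply: submodB => //; apply: lspan_sub gfs.
  apply/leq_sizeP => i; rewrite leq_eqVlt coefB => /orP[/eqP<-|hi].
    by rewrite ge subrr.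
  rewrite bg // subr0; apply: nth_default; exact: leq_trans hi.
by apply: lspan_sub gfs => // x xfs; apply: mem_lspan; rewrite mem_cat xfs orbT.
Qed.

Lemma noetherian_surj (A B : comNzRingType) (f : {rmorphism A -> B}) :
  (forall b, exists a, f a = b) -> noetherian A -> noetherian B.
Proof.
move=> fS nA N hN; have [N0 Nl] := hN.
have [|s hs] := nA (fun a => N (f a)).
  split; first by rewrite rmorph0.
  by move=> a u v Nu Nv; rewrite rmorphD rmorphM; apply: Nl.
apply: (@fin_genP B B^o N (map f s)) => // [_ /mapP[a sa ->]|b Nb].
  by apply/hs; apply: mem_lspan.
have [a ab] := fS b; rewrite -{}ab in Nb *; have {Nb} := (hs a).1 Nb.
elim: (s) a => [|x t IH] a /=; first by move=> ->; rewrite rmorph0.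
move=> [c /IH hc]; exists (f c); change (@lspan B B^o (map f t) (f a - f c * f x)).
have -> : f a - f c * f x = f (a - c * x) by rewrite rmorphB rmorphM.
exact: hc.
Qed.

Lemma noetherian_field (K : fieldType) : noetherian K.
Proof.
move=> N hN; case: (classic (exists x, N x /\ x != 0)) => [[x [Nx x0]]|h]; last first.
  apply: fin_gen0 => // v Nv; apply/eqP; apply: contra_notT h => v0; by exists v.
apply: (@fin_genP K K^o N [:: x]) => // [y|v _]; first by rewrite inE => /eqP->.
by exists (v / x); change (v - v / x * x = 0); rewrite mulfVK // subrr.
Qed.

Lemma mpoly_ind (A : nzRingType) n (P : {mpoly A[n]} -> Prop) :
  (forall c, P c%:MP) -> (forall i, P 'X_i) ->
  (forall p q, P p -> P q -> P (p + q)) ->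
  (forall p q, P p -> P q -> P (p * q)) -> forall p, P p.
Proof.
move=> PC PX PD PM; apply: mpolyind => [|c m p _ _ Pp]; first by rewrite -mpolyC0.
apply: PD => //; rewrite -mul_mpolyC; apply: (PM) => //.
rewrite mpolyXE_id; apply: (big_ind P) => // [|i _]; first by rewrite -mpolyC1.
by elim: (m i) => [|k IH]; rewrite ?expr0 -?mpolyC1 // exprS; apply: PM.
Qed.

Lemma noetherian_mpoly (K : fieldType) n : noetherian {mpoly K[n]}.
Proof.
elim: n => [|n IH].
  apply: (@noetherian_surj K _ (mpolyC 0 (R:=K)) _ (@noetherian_field K)) => p.
  exists p@_0%MM; exact: esym (nvar0_mpolyC p).
have cX : commr_rmorph (@mwiden n K) 'X_ord_max by move=> p; apply: mulrC.
apply: (@noetherian_surj _ _ (horner_morph cX) _ (noetherian_poly IH)).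
apply: mpoly_ind => [c|i|_ _ [p <-] [q <-]|_ _ [p <-] [q <-]].
- by exists (c%:MP)%:P; rewrite /= horner_morphC /= mwidenC.
- case: (unliftP ord_max i) => [j|] ->; last first.
    by exists 'X; rewrite /= horner_morphX.
  exists ('X_j)%:P; rewrite /= horner_morphC /= mwidenX mnmwiden1.
  by congr mpolyX; congr mnm1; apply: val_inj; rewrite /= /bump leqNgt ltn_ord.
- by exists (p + q); rewrite rmorphD.
- by exists (p * q); rewrite rmorphM.
Qed.

(** * The Koszul complex of commuting operators *)

Definition zmorph (M M' : zmodType) (f : M -> M') : Prop :=
  {morph f : u v / u - v}.

Section ZMorph.
Variables (M M' : zmodType) (f : M -> M').
Hypothesis fA : zmorph f.

Lemma zmorph0 : f 0 = 0.
Proof. by rewrite -(subrr 0) fA subrr. Qed.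

Lemma zmorphN : {morph f : u / - u}.
Proof. by move=> u; rewrite -sub0r fA zmorph0 sub0r. Qed.

Lemma zmorphD : {morph f : u v / u + v}.
Proof. by move=> u v; rewrite -{1}[v]opprK fA zmorphN opprK. Qed.
End ZMorph.

Definition subgroup (M : zmodType) (P : M -> Prop) : Prop :=
  P 0 /\ forall u v, P u -> P v -> P (u - v).

Section Subgroup.
Variables (M : zmodType) (P : M -> Prop).
Hypothesis hP : subgroup P.

Lemma subgroup0 : P 0. Proof. exact: hP.1. Qed.

Lemma subgroupB u v : P u -> P v -> P (u - v).
Proof. exact: hP.2. Qed.

Lemma subgroupN u : P u -> P (- u).
Proof. by rewrite -sub0r; apply: hP.2; exact: hP.1. Qed.

Lemma subgroupD u v : P u -> P v -> P (u + v).
Proof. by move=> hu hv; rewrite -[v]opprK; apply: hP.2 => //; apply: subgroupN. Qed.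

Lemma subgroup_congr u v : P (u - v) -> P v -> P u.
Proof. by move=> h hv; rewrite -(subrK v u); apply: subgroupD. Qed.
End Subgroup.

Lemma subgroup_eq0 (M : zmodType) : subgroup (fun v : M => v = 0).
Proof. by split=> // u v -> ->; rewrite subrr. Qed.

(** The exterior algebra on n generators with coefficients in M: an element of
    rank n + 1 is a + b e with a, b of rank n and e the last generator. *)
Fixpoint kchain (M : zmodType) (n : nat) : zmodType :=
  if n is n'.+1 then (kchain M n' * kchain M n')%type else M.

Fixpoint kmap (M M' : zmodType) (f : M -> M') n : kchain M n -> kchain M' n :=
  if n is n'.+1 then fun c => (kmap f c.1, kmap f c.2) else f.

(** The Koszul differential of the operators x 0, ..., x (n - 1), as the iterated
    mapping cone: d (a + b e) = d a + x (n - 1) b - (d b) e. *)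
Fixpoint kdiff (M : zmodType) (x : nat -> M -> M) n : kchain M n -> kchain M n :=
  if n is n'.+1 then
    fun c => (kdiff x c.1 + kmap (x n') c.2, - kdiff x c.2)
  else fun=> 0.

(** The elements of exterior degree i all of whose coefficients satisfy P. The
    same predicate expresses homogeneity and membership in a submodule, and with i
    an integer the recursion has no exceptional bottom degree. *)
Fixpoint kin (M : zmodType) (P : M -> Prop) n (i : int) : kchain M n -> Prop :=
  if n is n'.+1 then fun c => kin P i c.1 /\ kin P (i - 1) c.2
  else fun c => if i == 0 then P c else c = 0.

Section KMap.
Variables (M M' : zmodType) (f : M -> M').
Hypothesis fA : zmorph f.

Lemma kmapA n : zmorph (@kmap _ _ f n).
Proof. by elim: n => [|n IH] //= u v; congr pair; apply: IH. Qed.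

Lemma kmap0 n : kmap f (0 : kchain M n) = 0.
Proof. exact: (zmorph0 (@kmapA n)). Qed.

Lemma kmapN n : {morph @kmap _ _ f n : u / - u}.
Proof. exact: (zmorphN (@kmapA n)). Qed.

Lemma kmapD n : {morph @kmap _ _ f n : u v / u + v}.
Proof. exact: (zmorphD (@kmapA n)). Qed.

Lemma kmap_diff (x : nat -> M -> M) (x' : nat -> M' -> M') n (c : kchain M n) :
  (forall k v, (k < n)%N -> f (x k v) = x' k (f v)) ->
  kmap f (kdiff x c) = kdiff x' (kmap f c).
Proof.
elim: n c => [|n IH] c h; first exact: zmorph0.
case: c => a b /=; have h' k v : (k < n)%N -> f (x k v) = x' k (f v).
  by move=> kn; apply: h; apply: leqW.
rewrite kmapD kmapN !IH //; congr (_ + _, _).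
have {}h := h n _ (ltnSn n).
move: (x n) (x' n) h => y y' h.
by elim: {a IH h'} n b => //= n IH b; rewrite !IH.
Qed.
End KMap.

Lemma kmap_comp (M1 M2 M3 : zmodType) (f : M2 -> M3) (g : M1 -> M2) n
    (c : kchain M1 n) : kmap f (kmap g c) = kmap (f \o g) c.
Proof. by elim: n c => //= n IH c; rewrite !IH. Qed.

Lemma kmap_eq (M M' : zmodType) (f g : M -> M') n (c : kchain M n) :
  f =1 g -> kmap f c = kmap g c.
Proof. by move=> e; elim: n c => //= n IH c; rewrite !IH. Qed.

Lemma kmap_sub (M M' : zmodType) (f g h : M -> M') n (c : kchain M n) :
  (forall v, h v = f v - g v) -> kmap h c = kmap f c - kmap g c.
Proof. by move=> e; elim: n c => //= n IH c; rewrite !IH. Qed.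

Lemma kmap_id (M : zmodType) n (c : kchain M n) : kmap id c = c.
Proof. by elim: n c => //= n IH [a b]; rewrite !IH. Qed.

Section KIn.
Variables (M : zmodType).
Implicit Types (P Q : M -> Prop).

Lemma kin_sub P n i : subgroup P -> subgroup (@kin M P n i).
Proof.
move=> hP; elim: n i => [|n IH] i; split=> [|u v] /=.
- by case: ifP => // _; apply: subgroup0.
- by case: ifP => [_|_ -> ->]; [apply: subgroupB | rewrite subrr].
- by split; apply: subgroup0.
- by move=> [u1 u2] [v1 v2]; split; apply: subgroupB.
Qed.

Lemma kin_imp P Q n i (c : kchain M n) :
  (forall v, P v -> Q v) -> kin P i c -> kin Q i c.
Proof.
move=> h; elim: n i c => [|n IH] i c /=; first by case: ifP => // _; apply: h.
by move=> [h1 h2]; split; apply: IH.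
Qed.

Lemma kin_and P Q n i (c : kchain M n) :
  kin P i c -> kin Q i c -> kin (fun v => P v /\ Q v) i c.
Proof.
elim: n i c => [|n IH] i c /=; first by case: ifP.
by move=> [h1 h2] [h3 h4]; split; apply: IH.
Qed.

Lemma kin_all0 n i (c : kchain M n) : kin (fun v => v = 0) i c -> c = 0.
Proof.
elim: n i c => [|n IH] i c /=; first by case: ifP.
by case: c => a b /= [/IH -> /IH ->].
Qed.

Lemma kin_gt P n i (c : kchain M n) : (n%:Z < i) -> kin P i c -> c = 0.
Proof.
elim: n i c => [|n IH] i c ni /=; first by case: eqP => // i0; lia.
by case: c => a b /= [h1 h2]; rewrite (IH _ _ _ h1) ?(IH _ _ _ h2) //; lia.
Qed.

Lemma kin_lt0 P n i (c : kchain M n) : i < 0 -> kin P i c -> c = 0.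
Proof.
elim: n i c => [|n IH] i c ni /=; first by case: eqP => // i0; lia.
by case: c => a b /= [h1 h2]; rewrite (IH _ _ _ h1) // (IH _ _ _ h2) //; lia.
Qed.

Lemma kin_diff P Q (x : nat -> M -> M) n i (c : kchain M n) :
  subgroup Q -> (forall k v, (k < n)%N -> P v -> Q (x k v)) ->
  (forall k, (k < n)%N -> x k 0 = 0) ->
  kin P i c -> kin Q (i - 1) (kdiff x c).
Proof.
move=> hQ; elim: n i c => [|n IH] i c h h0 /=.
  by move=> _; case: ifP => // _; apply: subgroup0.
case: c => a b /=; have h' k v : (k < n)%N -> P v -> Q (x k v).
  by move=> kn; apply: h; apply: leqW.
have h0' k : (k < n)%N -> x k 0 = 0 by move=> kn; apply: h0; apply: leqW.
move=> [h1 h2]; split; last by apply: (subgroupN (kin_sub _ _ hQ)); apply: IH.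
apply: (subgroupD (kin_sub _ _ hQ)); first exact: IH.
have {}h v := h n v (ltnSn n); have {}h0 := h0 n (ltnSn n).
move: (x n) h h0 => y h h0.
elim: {a IH h' h0' h1} n (i - 1) b h2 => [|n IH] j b /=.
  by case: ifP => _; [apply: h | move=> ->; exact: h0].
by move=> [h3 h4]; split; apply: IH.
Qed.
End KIn.

Lemma kin_map (M M' : zmodType) (f : M -> M') (P : M -> Prop) (Q : M' -> Prop)
    n i (c : kchain M n) :
  (forall v, P v -> Q (f v)) -> f 0 = 0 -> kin P i c -> kin Q i (kmap f c).
Proof.
move=> h h0; elim: n i c => [|n IH] i c /=.
  by case: ifP => _; [apply: h | move=> ->].
by move=> [h1 h2]; split; apply: IH.
Qed.

Lemma kin_unmap (M M' : zmodType) (f : M -> M') (P R : M -> Prop) (Q : M' -> Prop)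
    n i (c : kchain M n) :
  (forall v, Q (f v) -> P v) -> kin R i c -> kin Q i (kmap f c) -> kin P i c.
Proof.
move=> h; elim: n i c => [|n IH] i c /=; first by case: ifP => _ // _; apply: h.
by move=> [h1 h2] [h3 h4]; split; apply: IH.
Qed.

Lemma kin_lift (M M' : zmodType) (f : M -> M') (P : M -> Prop)
    (Q N : M' -> Prop) n i (c : kchain M' n) :
  f 0 = 0 -> N 0 -> (forall v, Q v -> exists2 w, P w & N (v - f w)) ->
  kin Q i c -> exists2 b, kin P i b & kin N i (c - kmap f b).
Proof.
move=> f0 N0 h; elim: n i c => [|n IH] i c /=.
  case: ifP => _; first exact: h.
  by move=> ->; exists 0; rewrite // f0 subr0.
by case: c => a b /= [/IH [a' ? ?] /IH [b' ? ?]]; exists (a', b').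
Qed.

(** * Koszul homology of quotients *)

(** A graded abelian group with commuting operators of degree 1: what a graded
    module over a polynomial ring is for its Koszul complex. *)
Record op_module := OpModule {
  om_sort :> zmodType;
  op : nat -> om_sort -> om_sort;
  hom : int -> om_sort -> Prop;
  op_morph : forall k, zmorph (op k);
  op_comm : forall k l v, op k (op l v) = op l (op k v);
  hom_sub : forall t, subgroup (hom t);
  op_hom : forall k t v, hom t v -> hom (t + 1) (op k v) }.

Arguments hom_sub {o} t.
Arguments hom {o} t v.

Definition op_closed (M : op_module) (N : M -> Prop) : Prop :=
  subgroup N /\ forall k v, N v -> N (op k v).

(** With i the exterior degree and t the degree of the coefficients, this is the
    vanishing of the Koszul homology of M / N in homological degree i and
    internal degree i + t; regularity bounds t. *)
Definition vanish (M : op_module) n (N : M -> Prop) (i t : int) : Prop :=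
  forall c : kchain M n, kin (hom t) i c -> kin N (i - 1) (kdiff (@op M) c) ->
  exists b : kchain M n,
    kin (hom (t - 1)) (i + 1) b /\ kin N i (c - kdiff (@op M) b).

Definition acyclic (M : op_module) n : Prop :=
  forall i t (c : kchain M n), i != 0 ->
  kin (hom t) i c -> kdiff (@op M) c = 0 ->
  exists b : kchain M n, kin (hom (t - 1)) (i + 1) b /\ c = kdiff (@op M) b.

Section OpModule.
Variable M : op_module.
Local Notation x := (@op M).

Lemma op0 k : x k 0 = 0. Proof. exact: (zmorph0 (@op_morph M k)). Qed.

Lemma kdiffA n : zmorph (@kdiff M x n).
Proof.
elim: n => [|n IH] u v /=; first by rewrite subr0.
rewrite !IH (kmapA (@op_morph M n)); congr pair => /=; last by rewrite opprD.
by rewrite addrACA -opprD.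
Qed.

Lemma kdiff0 n : kdiff x (0 : kchain M n) = 0.
Proof. exact: (zmorph0 (@kdiffA n)). Qed.

Lemma kdiffN n : {morph @kdiff M x n : u / - u}.
Proof. exact: (zmorphN (@kdiffA n)). Qed.

Lemma kdiffD n : {morph @kdiff M x n : u v / u + v}.
Proof. exact: (zmorphD (@kdiffA n)). Qed.

Lemma kdiff_op n k (c : kchain M n) : kmap (x k) (kdiff x c) = kdiff x (kmap (x k) c).
Proof. by apply: kmap_diff => [|l v _]; [exact: op_morph | exact: op_comm]. Qed.

Lemma kdiff_diff n (c : kchain M n) : kdiff x (kdiff x c) = 0.
Proof.
elim: n c => [|n IH] c //; case: c => a b /=.
rewrite kdiffD IH add0r (kmapN (@op_morph M n)) kdiff_op subrr.
by rewrite kdiffN IH !oppr0.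
Qed.

Lemma kin_diff_hom n i t (c : kchain M n) :
  kin (hom (t - 1)) (i + 1) c -> kin (hom t) i (kdiff x c).
Proof.
rewrite -{2}(addrK 1 i); apply: kin_diff => [|k v _ /op_hom|k _]; first exact: hom_sub.
  by move=> /(_ k); rewrite subrK.
exact: op0.
Qed.

Lemma kin_diff_homS n i t (c : kchain M n) :
  kin (hom t) i c -> kin (hom (t + 1)) (i - 1) (kdiff x c).
Proof. by move=> h; apply: kin_diff_hom; rewrite addrK subrK. Qed.

Lemma kin_diff_closed N n i (c : kchain M n) :
  op_closed N -> kin N (i + 1) c -> kin N i (kdiff x c).
Proof.
move=> [hN Nx]; rewrite -{2}(addrK 1 i); apply: kin_diff => // [k v _|k _].
  exact: Nx.
exact: op0.
Qed.

(** A partial inverse of the last operator that commutes with the earlier ones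
    contracts the Koszul complex onto that of the earlier operators. *)
Lemma acyclic_of_div n (q : nat -> M -> M) :
  (forall k, (k < n)%N -> zmorph (q k)) ->
  (forall k v, (k < n)%N -> q k (x k v) = v) ->
  (forall k l v, (l < k < n)%N -> q k (x l v) = x l (q k v)) ->
  (forall k t v, (k < n)%N -> hom t v -> hom (t - 1) (q k v)) ->
  acyclic M n.
Proof.
elim: n => [|n IH] qA qx qC qh i t c i0.
  rewrite /= (negbTE i0) => -> _; exists 0; split=> //.
  exact: (@subgroup0 _ _ (@kin_sub M (hom (t - 1)) 0 (i + 1) (hom_sub (t - 1)))).
case: c => a b /= [ha hb] [dab /eqP]; rewrite oppr_eq0 => /eqP db.
have {qA}qA : zmorph (q n) /\ forall k, (k < n)%N -> zmorph (q k).
  by split=> [|k kn]; apply: qA => //; apply: leqW.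
have dQ : kdiff x (kmap (q n) a) = - b.
  rewrite -(@kmap_diff _ _ _ qA.1 x) => [|l v ln]; last by rewrite qC ?ln /=.
  move/eqP: dab; rewrite addr_eq0 => /eqP ->; rewrite (kmapN qA.1); congr (- _).
  by rewrite kmap_comp -[RHS]kmap_id; apply: kmap_eq => v /=; apply: qx.
have hQ : kin (hom (t - 1)) i (kmap (q n) a).
  by apply: kin_map ha => [v|]; [exact: qh | exact: (zmorph0 qA.1)].
have [||||||e [he de]] := IH _ _ _ _ i t (a - kmap (x n) (kmap (q n) a)) i0.
- exact: qA.2.
- by move=> k v kn; apply: qx; apply: leqW.
- by move=> k l v /andP[lk kn]; apply: qC; rewrite lk leqW.
- by move=> k s v kn; apply: qh; apply: leqW.
- apply: (subgroupB (kin_sub _ _ (hom_sub _))) => //.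
  by apply: kin_map hQ => [v /op_hom|]; [move/(_ n); rewrite subrK | exact: op0].
- rewrite kdiffA -kdiff_op dQ (kmapN (@op_morph M n)) opprK; exact: dab.
(* The second component of the witness makes its boundary agree with c up to
   a chain of the earlier operators, which the first component bounds. *)
by exists (e, kmap (q n) a); rewrite /= addrK -de subrK dQ opprK.
Qed.

Fixpoint kconst n (v : M) : kchain M n :=
  if n is n'.+1 then (kconst n' v, 0) else v.

(** The combinations of the operators x 0, ..., x (n - 1) with coefficients in P,
    in the form in which they are boundaries of chains of degree 1. *)
Fixpoint op_span n (P : M -> Prop) (v : M) : Prop :=
  if n is n'.+1 then exists2 u, P u & op_span n' P (v - x n' u) else v = 0.

Lemma kconstD n : {morph kconst n : u v / u + v}.
Proof. by elim: n => [|n IH] u v //=; rewrite IH; congr pair; rewrite addr0. Qed.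

Lemma kdiff_const n v : kdiff x (kconst n v) = 0.
Proof.
by elim: n => [|n IH] //=; rewrite IH (kmap0 (@op_morph M n)) kdiff0 addr0 oppr0.
Qed.

Lemma kmap_const (f : M -> M) n v : zmorph f -> kmap f (kconst n v) = kconst n (f v).
Proof. by move=> fA; elim: n => [|n IH] //=; rewrite IH (kmap0 fA). Qed.

Lemma kin_const P n v : P 0 -> kin P 0 (kconst n v) <-> P v.
Proof.
move=> P0; elim: n => [|n IH] /=; first by [].
rewrite IH; split=> [[]//|Pv]; split=> //.
elim: {IH} n (0 - 1) => [|n IH] i /=; [by case: ifP | by split; apply: IH].
Qed.

Lemma kin0P P n (c : kchain M n) : kin P 0 c -> exists2 v, P v & c = kconst n v.
Proof.
elim: n c => [|n IH] c /=; first by exists c.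
case: c => a b /= [/IH[v Pv ->] hb]; exists v => //.
by rewrite (kin_lt0 _ hb).
Qed.

Lemma op_span_boundary n P v : P 0 -> op_span n P v ->
  exists2 b : kchain M n, kin P 1 b & kconst n v = kdiff x b.
Proof.
move=> P0; elim: n v => [|n IH] v /=; first by move=> ->; exists 0.
move=> [u Pu /IH[b hb db]]; exists (b, kconst n u) => /=.
  by split=> //; apply/kin_const.
rewrite -db kdiff_const oppr0 kmap_const; last exact: op_morph.
by rewrite -kconstD subrK.
Qed.

(** Operators with values in N act by zero on M / N, and then the Koszul complex
    is a sum of shifted copies of the one of the other operators; the shifts keep
    the degree t of the coefficients. *)
Lemma vanish_op_zero n N t : op_closed N -> (forall v, N (x n v)) ->
  (forall i, vanish n.+1 N i t) <-> (forall i, vanish n N i t).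
Proof.
move=> [hN Nx] Nn; have kN m i := @kin_sub M N m i hN.
have kmapN' m i P (c : kchain M m) : kin P i c -> kin N i (kmap (x n) c).
  by apply: kin_map => //; apply: op0.
split=> h i.
  move=> a ha da.
  have [||e] := h i (a, 0) => /=.
  - by split=> //; exact: (subgroup0 (kin_sub _ _ (hom_sub _))).
  - rewrite kdiff0 oppr0 (kmap0 (@op_morph M n)) addr0; split=> //.
    exact: (subgroup0 (kN _ _)).
  case: e => [e1 e2] /= [[h1 h2] [h3 h4]]; exists e1; split=> //.
  have -> : a - kdiff x e1 = a - (kdiff x e1 + kmap (x n) e2) + kmap (x n) e2.
    by rewrite opprD addrA subrK.
  apply: (subgroupD (kN _ _) h3); rewrite addrK in h2; exact: kmapN' h2.
case=> a b /= [ha hb] [da db].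
have {}da : kin N (i - 1) (kdiff x a).
  by rewrite -[kdiff x a](addrK (kmap (x n) b)); apply: (subgroupB (kN _ _)) (kmapN' _ _ _ _ hb).
have {}db : kin N (i - 1 - 1) (kdiff x b).
  by rewrite -[kdiff x b]opprK; apply: (subgroupN (kN _ _)).
have [a1 [ha1 da1]] := h i a ha da.
have [b1 [hb1 db1]] := h (i - 1) b hb db.
rewrite subrK in hb1; exists (a1, - b1) => /=; rewrite addrK; split; last first.
  rewrite kdiffN opprK; split=> //; rewrite (kmapN (@op_morph M n)) opprB addrCA.
  by apply: (subgroupD (kN _ _)) => //; apply: kmapN' hb1.
split=> //; apply: (subgroupN (kin_sub _ _ (hom_sub _))).
exact: hb1.
Qed.
End OpModule.

Definition graded_map (M M' : op_module) n (f : M -> M') : Prop :=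
  [/\ zmorph f, forall k v, (k < n)%N -> f (op k v) = op k (f v)
    & forall t v, hom t v -> hom t (f v)].

(** Koszul homology depends on the quotient module only, whichever module
    presents it. *)
Lemma vanish_iso (M M' : op_module) n (f : M -> M') N N' :
  graded_map n f -> op_closed N' -> (forall v, N v <-> N' (f v)) ->
  (forall t v', hom t v' -> exists2 v, hom t v & N' (v' - f v)) ->
  forall i t, vanish n N i t <-> vanish n N' i t.
Proof.
move=> [fA fx fh] N'c NN' lift i t; have [hN' _] := N'c.
have f0 := zmorph0 fA; have kA := kmapA fA.
have kN m j := @kin_sub M' N' m j hN'.
have kd m (c : kchain M m) : (m <= n)%N -> kmap f (kdiff (@op M) c) = kdiff (@op M') (kmap f c).
  by move=> mn; apply: kmap_diff => // k v km; apply: fx; apply: leq_trans mn.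
have klift s j (c : kchain M' n) : kin (hom s) j c ->
    exists2 b, kin (hom s) j b & kin N' j (c - kmap f b).
  by apply: kin_lift => //; [apply: subgroup0 | apply: lift].
have khom s j m (c : kchain M m) : kin (hom s) j c -> kin (hom s) j (kmap f c).
  by apply: kin_map => // v; apply: fh.
have kunmap s j m (c : kchain M m) : kin (hom s) j c -> kin N' j (kmap f c) -> kin N j c.
  by apply: kin_unmap => v /NN'.
split=> h c hc dc.
  have [b hb cb] := klift _ _ _ hc.
  have [|e [he de]] := h b hb.
    apply: kunmap (kin_diff_homS hb) _; rewrite kd //.
    rewrite -[kmap f b](subKr c) kdiffA; apply: (subgroupB (kN _ _)) => //.
    by apply: kin_diff_closed => //; rewrite subrK.
  exists (kmap f e); split; first exact: khom.
  rewrite -kd // -(subrK (kmap f b) c) -addrA; apply: (subgroupD (kN _ _)) => //.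
  by rewrite -kA; apply: kin_map de => // v /NN'.
have [||b [hb db]] := h (kmap f c); first exact: khom.
  by rewrite -kd //; apply: kin_map dc => // v /NN'.
have [e he be] := klift _ _ _ hb.
exists e; split=> //; apply: (kunmap t).
  by apply: (subgroupB (kin_sub _ _ (hom_sub _))) => //; apply: kin_diff_hom.
rewrite kA kd // -(subrK (kdiff (@op M') b) (kmap f c)) -addrA.
by apply: (subgroupD (kN _ _)) => //; rewrite -kdiffA; apply: kin_diff_closed.
Qed.

(** Dimension shift: G maps onto the submodule Z of F with kernel Z', so that the
    homology of F / Z is that of G / Z' one step lower. In homological degree 0
    this needs the image of G to vanish modulo the operators, which is what
    minimality of a resolution provides. *)
Lemma vanish_shift (F G : op_module) n (f : G -> F) Z Z' (i : nat) t :
  graded_map n f -> op_closed Z -> acyclic F n ->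
  (forall t v, hom t v -> Z v -> exists2 w, hom t w & v = f w) ->
  (forall w, Z (f w)) -> (forall w, f w = 0 <-> Z' w) ->
  (forall t w, hom t w -> op_span n (hom (t - 1)) (f w)) ->
  vanish n Z i.+1 t <-> vanish n Z' i (t + 1).
Proof.
move=> [fA fx fh] [hZ Zx] acF lift Zf Z'f fmin.
have f0 := zmorph0 fA; have kA := kmapA fA.
have kd (c : kchain G n) : kmap f (kdiff (@op G) c) = kdiff (@op F) (kmap f c).
  exact: kmap_diff.
have klift s j (c : kchain F n) : kin (hom s) j c -> kin Z j c ->
    exists2 b, kin (hom s) j b & c = kmap f b.
  move=> h1 h2; have [||b hb] :=
    @kin_lift _ _ f (hom s) _ (fun v => v = 0) _ _ _ f0 _ _ (kin_and h1 h2) => //.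
    by move=> v [hv /lift -/(_ _ hv)[w hw ->]]; exists w; rewrite // subrr.
  by move=> /kin_all0 /eqP; rewrite subr_eq0 => /eqP ->; exists b.
have khom s j (c : kchain G n) : kin (hom s) j c -> kin (hom s) j (kmap f c).
  by apply: kin_map => // v; apply: fh.
have kZ j P (c : kchain G n) : kin P j c -> kin Z j (kmap f c).
  by apply: kin_map => // v.
have kker j P (c : kchain G n) : kin P j c -> kmap f c = 0 -> kin Z' j c.
  move=> hc fc; apply: (@kin_unmap _ _ f Z' P (fun v => v = 0)) hc _ => [v /Z'f//|].
  by rewrite fc; apply: (subgroup0 (kin_sub _ _ (subgroup_eq0 _))).
have Si : i.+1%:Z - 1 = i by lia.
have iS : i.+1%:Z = i%:Z + 1 by lia.
split=> h c hc dc; last first.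
  rewrite Si in dc.
  have [g hg dg] : exists2 g, kin (hom (t + 1)) i g & kdiff (@op F) c = kmap f g.
    by apply: klift => //; apply: kin_diff_hom; rewrite addrK -Si subrK.
  have [|b [hb db]] := h g hg.
    by apply: kker (kin_diff_homS hg) _; rewrite kd -dg kdiff_diff.
  rewrite addrK in hb.
  have eb : kmap f g = kmap f (kdiff (@op G) b).
    apply/eqP; rewrite -subr_eq0 -kA; apply/eqP.
    apply: (@kin_all0 _ _ i); apply: kin_map db => // v /Z'f //.
  rewrite -iS in hb; have hb' := khom _ _ _ hb.
  have [|||e [he ce]] := acF i.+1 t (c - kmap f b) => //.
    by apply: (subgroupB (kin_sub _ _ (hom_sub _))).
    by rewrite kdiffA dg eb kd subrr.
  exists e; split=> //; rewrite -ce subKr; exact: kZ hb.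
have [b hb eb] : exists2 b, kin (hom t) (i%:Z + 1) b & kmap f c = kdiff (@op F) b.
  case: (posnP i) => [i0|i_gt0].
    move: hc; rewrite i0 => /kin0P[v hv ->].
    have := op_span_boundary (subgroup0 (hom_sub _)) (fmin _ _ hv).
    rewrite addrK add0r => -[b hb eb]; exists b => //.
    by rewrite -eb; elim: (n) => //= m ->; rewrite (kmap0 fA).
  have [|||b [hb eb]] := acF i (t + 1) (kmap f c); first by lia.
  - exact: khom.
  - rewrite -kd; apply: (@kin_all0 _ _ (i%:Z - 1)).
    by apply: kin_map dc => // v /Z'f.
  by rewrite addrK in hb; exists b.
have [||e [he de]] := h b; first by rewrite iS.
  by rewrite Si -eb; apply: kZ hc.
have [||g hg eg] := klift t i.+1 (b - kdiff (@op F) e) => //.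
  apply: (subgroupB (kin_sub _ _ (hom_sub _))); first by rewrite iS.
  exact: kin_diff_hom.
exists g; rewrite addrK -iS; split=> //.
apply: (kker _ (hom (t + 1))).
  apply: (subgroupB (kin_sub _ _ (hom_sub _))) => //.
  by apply: kin_diff_hom; rewrite addrK -iS.
by rewrite kA kd -eg kdiffA kdiff_diff subr0 eb subrr.
Qed.

(** * A Mayer-Vietoris principle *)

(** Mayer-Vietoris for N1, N2 and M / (N1 + N2) concentrated in degree 0: the
    projection e splits every element of positive degree into one of N1 and one
    of N2, so cycles and their bounding chains can be corrected coefficientwise. *)
Section MayerVietoris.
Variables (M : op_module) (n : nat) (N1 N2 : M -> Prop) (e : M -> M).
Hypotheses (N1c : op_closed N1) (N2c : op_closed N2) (eA : zmorph e).
Hypothesis eh : forall t v, hom t v -> hom t (e v).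
Hypothesis e1 : forall t v, 0 < t -> hom t v -> N1 (v - e v).
Hypothesis e2 : forall t v, 0 < t -> hom t v -> N2 (e v).

Let kN1 m i := @kin_sub M N1 m i N1c.1.
Let kN2 m i := @kin_sub M N2 m i N2c.1.

Let ke t i (c : kchain M n) : kin (hom t) i c -> kin (hom t) i (kmap e c).
Proof. by apply: kin_map => [v|]; [exact: eh | exact: zmorph0]. Qed.

Let ke1 t i (c : kchain M n) :
  0 < t -> kin (hom t) i c -> kin N1 i (c - kmap e c).
Proof.
move=> t0 hc; rewrite -{1}[c]kmap_id -(@kmap_sub _ _ id e (fun v => v - e v)) //.
by apply: kin_map hc => [v|]; [exact: e1 | rewrite (zmorph0 eA) subrr].
Qed.

Let ke2 t i (c : kchain M n) : 0 < t -> kin (hom t) i c -> kin N2 i (kmap e c).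
Proof. by move=> t0; apply: kin_map => [v|]; [exact: e2 | exact: zmorph0]. Qed.

Lemma vanish_cap_left i t : 0 < t ->
  vanish n (fun v => N1 v /\ N2 v) i t -> vanish n N1 i t.
Proof.
move=> t0 h c hc dc; have [||b [hb db]] := h (kmap e c); first exact: ke.
  apply: kin_and; last by apply: kin_diff_closed => //; rewrite subrK; apply: ke2 hc.
  rewrite -[kmap e c](subKr c) kdiffA; apply: (subgroupB (kN1 _ _)) => //.
  by apply: kin_diff_closed => //; rewrite subrK; apply: ke1 hc.
exists b; split=> //; rewrite -(subrK (kmap e c) c) -addrA.
apply: (subgroupD (kN1 _ _)); first exact: ke1 hc.
by apply: kin_imp db => v [].
Qed.

Lemma vanish_cap i t : 1 < t ->
  vanish n N1 i t -> vanish n N2 i t -> vanish n (fun v => N1 v /\ N2 v) i t.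
Proof.
move=> t1 h1 h2 c hc dc.
have [||a [ha da]] := h1 c => //; first by apply: kin_imp dc => v [].
have [||b [hb db]] := h2 c => //; first by apply: kin_imp dc => v [].
have t0 : 0 < t - 1 by lia.
pose w := a - b; have hw : kin (hom (t - 1)) (i + 1) w.
  exact: (subgroupB (kin_sub _ _ (hom_sub _))).
(* Chosen to differ from a by an element of N1 and from b by one of N2. *)
exists (a - (w - kmap e w)); split.
  by do 2!apply: (subgroupB (kin_sub _ _ (hom_sub _))) => //; apply: ke.
apply: kin_and.
  rewrite kdiffA opprB addrCA; apply: (subgroupD (kN1 _ _)) => //.
  by apply: kin_diff_closed => //; apply: ke1 hw.
have -> : a - (w - kmap e w) = b + kmap e w by rewrite opprB addrCA /w subKr addrC.
rewrite kdiffD opprD addrA; apply: (subgroupB (kN2 _ _)) => //.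
by apply: kin_diff_closed => //; apply: ke2 hw.
Qed.
End MayerVietoris.

(** * Gradings of polynomial rings *)

Section Grading.
Variables (K : fieldType) (n : nat).
Local Notation R := {mpoly K[n]}.
Implicit Types p q : R.

Lemma homog_of_degP z p :
  homog_of_deg z p <-> forall m, p@_m != 0 -> (mdeg m)%:Z = z.
Proof.
split=> [[->|[d [-> /dhomogP hp]]] m|h]; first by rewrite mcoeff0 eqxx.
  by rewrite -mcoeff_msupp => /hp ->.
have [->|p0] := eqVneq p 0; first by left.
right; have [m mp] : exists m, m \in msupp p.
  by move: p0; rewrite -msupp_eq0; case: (msupp p) => // m s _; exists m; rewrite mem_head.
exists (mdeg m); split; first by apply/esym/h; rewrite -mcoeff_msupp.
apply/dhomogP => m' mp'; apply/eqP; rewrite -eqz_nat; apply/eqP.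
by rewrite !h // -mcoeff_msupp.
Qed.

Lemma homog_coeff0 z p m : homog_of_deg z p -> (mdeg m)%:Z != z -> p@_m = 0.
Proof.
by move=> /homog_of_degP h; apply: contraNeq => /h ->.
Qed.

Lemma homog_sub z : subgroup (@homog_of_deg K n z).
Proof.
split=> [|p q /homog_of_degP hp /homog_of_degP hq]; first by left.
apply/homog_of_degP => m; rewrite mcoeffB.
have [p0|/hp//] := eqVneq (p@_m) 0; rewrite p0 sub0r oppr_eq0; exact: hq.
Qed.

Lemma homogM z d p q :
  homog_of_deg z p -> homog_of_deg d q -> homog_of_deg (z + d) (p * q).
Proof.
move=> [->|[a [-> hp]]]; first by left; rewrite mul0r.
move=> [->|[b [-> hq]]]; first by left; rewrite mulr0.
by right; exists (a + b)%N; split=> //; apply: dhomogM.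
Qed.

Lemma homogX i : homog_of_deg 1 ('X_i : R).
Proof. by right; exists 1%N; split=> //; rewrite dhomogX /= mdeg1. Qed.

Lemma homogC c : homog_of_deg 0 (c%:MP : R).
Proof.
apply/homog_of_degP => m; rewrite mcoeffC.
by have [->|] := eqVneq m 0%MM; rewrite ?mdeg0 // mulr0 eqxx.
Qed.

Lemma homog_neg z p : z < 0 -> homog_of_deg z p -> p = 0.
Proof. by move=> z0 [//|[d [e _]]]; lia. Qed.

(** The homogeneous component of degree z. *)
Definition pcomp (z : int) p : R := if z is Posz d then pihomog mdeg d p else 0.

Lemma mcoeff_pcomp z p m :
  (pcomp z p)@_m = if (mdeg m)%:Z == z then p@_m else 0.
Proof.
case: z => [d|d] /=; last by rewrite mcoeff0.
rewrite eqz_nat (@pihomogwE _ _ _ _ (msize p)) // raddf_sum /=.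
case: (ltnP (mdeg m) (msize p)) => [mp|/msize_mdeg_ge/memN_msupp_eq0 pm]; last first.
  rewrite pm if_same; apply: big1 => i /eqP _; rewrite mcoeffZ mcoeffX.
  by have [->|] := eqVneq (i : 'X_{1..n}) m; rewrite ?pm ?mul0r ?mulr0.
rewrite big_mkcond (bigD1 (BMultinom mp)) //= big1 => [|i im].
  by rewrite addr0; case: ifP; rewrite // mcoeffZ mcoeffX eqxx mulr1.
case: ifP => // _; rewrite mcoeffZ mcoeffX.
by have [e|] := eqVneq (i : 'X_{1..n}) m; rewrite ?mulr0 //; case/eqP: im; apply: val_inj.
Qed.

Lemma pcomp_homog z p : homog_of_deg z (pcomp z p).
Proof.
by apply/homog_of_degP => m; rewrite mcoeff_pcomp; case: ifP => [/eqP//|_]; rewrite eqxx.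
Qed.

Lemma pcomp_id z p : homog_of_deg z p -> pcomp z p = p.
Proof.
move=> h; apply/mpolyP => m; rewrite mcoeff_pcomp; case: ifP => // /negbT.
by move/(homog_coeff0 h).
Qed.

Lemma pcomp_ne z d p : d != z -> homog_of_deg d p -> pcomp z p = 0.
Proof.
move=> dz h; apply/mpolyP => m; rewrite mcoeff_pcomp mcoeff0; case: eqP => // e.
by apply: (homog_coeff0 h); rewrite e eq_sym.
Qed.

Lemma pcompA z : zmorph (pcomp z).
Proof.
by move=> p q; apply/mpolyP => m; rewrite mcoeffB !mcoeff_pcomp mcoeffB; case: ifP; rewrite ?subr0.
Qed.

Lemma pcomp_sum z (I : Type) (s : seq I) (P : pred I) (F : I -> R) :
  pcomp z (\sum_(i <- s | P i) F i) = \sum_(i <- s | P i) pcomp z (F i).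
Proof.
apply: (big_morph _ (zmorphD (@pcompA z)) (zmorph0 (@pcompA z))).
Qed.

Lemma pcomp_partition p : p = \sum_(d < msize p) pcomp d p.
Proof. exact: pihomog_partitionE. Qed.

Lemma pcompM z d p q : homog_of_deg d q -> pcomp (z + d) (p * q) = pcomp z p * q.
Proof.
move=> hq; rewrite {1 2}[p]pcomp_partition mulr_suml !pcomp_sum mulr_suml.
apply: eq_bigr => i _; have hi := pcomp_homog i p.
have [<-|zi] := eqVneq (i : int) z.
  by rewrite (pcomp_id hi) (pcomp_id (homogM hi hq)).
rewrite (pcomp_ne zi hi) mul0r; apply: (pcomp_ne _ (homogM hi hq)).
by apply: contraNneq zi => /addIr ->.
Qed.

Lemma mcoeffXM i p m :
  ('X_i * p)@_m = if m i == 0%N then 0 else p@_(m - U_(i)).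
Proof.
case: eqP => [mi|/eqP]; last first.
  by rewrite -lep1mP => h; rewrite mulrC -{1}(submK h) addmC mcoeffMX.
apply: memN_msupp_eq0; apply/negP => /msuppM_le /allpairsP[[a b]] /= [].
rewrite msuppX inE => /eqP -> _ em; move: mi; rewrite em mnmDE mnm1E eqxx; lia.
Qed.

(** The quotient of the division by a variable. *)
Definition pdivX i p : R :=
  \sum_(m <- msupp p | (0 < m i)%N) p@_m *: 'X_[m - U_(i)].

Lemma mcoeff_pdivX i p m : (pdivX i p)@_m = p@_(m + U_(i)).
Proof.
rewrite {2}[p]mpolyE !raddf_sum /= big_mkcond /=; apply: eq_bigr => m' _.
rewrite !mcoeffZ !mcoeffX; case: posnP => [m0|mi].
  have [e|] := eqVneq m' (m + U_(i))%MM; last by rewrite mulr0.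
  by move: m0; rewrite e mnmDE mnm1E eqxx; lia.
congr (_ * _%:R); congr (nat_of_bool _).
have h : (U_(i) <= m')%MM by rewrite lep1mP -lt0n.
by rewrite -(eqm_add2r U_(i)) submK.
Qed.

Lemma pdivXA i : zmorph (pdivX i).
Proof. by move=> p q; apply/mpolyP => m; rewrite mcoeffB !mcoeff_pdivX mcoeffB. Qed.

Lemma pdivXK i p : pdivX i ('X_i * p) = p.
Proof.
apply/mpolyP => m; rewrite mcoeff_pdivX mcoeffXM mnmDE mnm1E eqxx addn1 /=.
by rewrite addmK.
Qed.

Lemma pdivX_comm i j p : i != j -> pdivX i ('X_j * p) = 'X_j * pdivX i p.
Proof.
move=> ij; apply/mpolyP => m; rewrite mcoeff_pdivX !mcoeffXM mcoeff_pdivX.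
rewrite mnmDE mnm1E (negbTE ij) addn0; case: eqP => // /eqP mj.
congr (_@__); apply/mnmP => k; rewrite !(mnmBE, mnmDE, mnm1E).
by have [<-|_] := eqVneq j k; [rewrite (negbTE ij) !addn0 | rewrite !subn0].
Qed.

Lemma pdivX_homog i z p : homog_of_deg z p -> homog_of_deg (z - 1) (pdivX i p).
Proof.
move=> /homog_of_degP h; apply/homog_of_degP => m; rewrite mcoeff_pdivX => /h <-.
by rewrite mdegD mdeg1; lia.
Qed.

Lemma mcoeff_divX_rem i p m :
  (p - 'X_i * pdivX i p)@_m = if m i == 0%N then p@_m else 0.
Proof.
rewrite mcoeffB mcoeffXM mcoeff_pdivX; case: eqP => [|/eqP]; first by rewrite subr0.
by rewrite -lep1mP => h; rewrite submK // subrr.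
Qed.

Lemma mcoeff0M p q : (p * q)@_0%MM = p@_0%MM * q@_0%MM.
Proof. exact: rmorphM. Qed.
End Grading.

(** * Ideals given by generators *)

Section GenIdeal.
Variables (R : comNzRingType) (S : R -> Prop).

Lemma gen_ideal_gen s : S s -> gen_ideal S s.
Proof.
move=> hs; exists 1%N, (fun=> 1), (fun=> s); split=> //.
by rewrite big_ord1 mul1r.
Qed.

Lemma gen_ideal0 : gen_ideal S 0.
Proof.
exists 0%N, (fun=> 0), (fun=> 0); split=> [[]//|]; by rewrite big_ord0.
Qed.

Lemma gen_idealD p q : gen_ideal S p -> gen_ideal S q -> gen_ideal S (p + q).
Proof.
move=> [m [a [s [hs ->]]]] [m' [a' [s' [hs' ->]]]].
pose glue f f' (i : 'I_(m + m')) : R :=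
  match split i with inl j => f j | inr j => f' j end.
exists (m + m')%N, (glue a a'), (glue s s'); split.
  by move=> i; rewrite /glue; case: split.
rewrite big_split_ord /=; congr (_ + _); apply: eq_bigr => i _; rewrite /glue.
  case: split_ordP => j /= /(congr1 val)/= e; last by have := ltn_ord i; lia.
  by have -> : i = j by apply: val_inj.
case: split_ordP => j /= /(congr1 val)/= e; first by have := ltn_ord j; lia.
by have -> : i = j by apply: val_inj => /=; lia.
Qed.

Lemma gen_idealM p q : gen_ideal S q -> gen_ideal S (p * q).
Proof.
move=> [m [a [s [hs ->]]]]; exists m, (fun i => p * a i), s; split=> //.
by rewrite mulr_sumr; apply: eq_bigr => i _; rewrite mulrA.
Qed.

Lemma gen_ideal_min (N : R -> Prop) :
  N 0 -> (forall p q, N p -> N q -> N (p + q)) ->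
  (forall p q, N q -> N (p * q)) -> (forall s, S s -> N s) ->
  forall p, gen_ideal S p -> N p.
Proof.
move=> N0 ND NM NS p [m [a [s [hs ->]]]].
by apply: (big_ind N) => // i _; apply: (NM); apply: NS.
Qed.

Lemma gen_ideal_submod : submodule (gen_ideal S : R^o -> Prop).
Proof.
split; first exact: gen_ideal0.
by move=> a u v hu hv; apply: gen_idealD => //; apply: gen_idealM.
Qed.
End GenIdeal.

Lemma max_homog_idealP (K : fieldType) n (p : {mpoly K[n]}) :
  max_homog_ideal p <-> p@_0%MM = 0.
Proof.
split=> [[m [a [s [hs ->]]]]|p0].
  rewrite raddf_sum /= big1 // => i _; have [j ->] := hs i.
  by rewrite mulrC mcoeffXM mnm0E.
rewrite -[p]subr0 -(mpolyC0 n K) -p0 {p0}.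
elim/mpoly_ind: p => [c|i|p q hp hq|p q hp hq].
- rewrite mcoeffC eqxx mulr1 subrr; exact: gen_ideal0.
- rewrite mcoeffX mnm1_eq0 mpolyC0 subr0; apply: gen_ideal_gen; by exists i.
- by rewrite mcoeffD mpolyCD opprD addrACA; apply: gen_idealD.
- rewrite mcoeff0M mpolyCM.
  set a := (p@_0%MM)%:MP; set b := (q@_0%MM)%:MP.
  have -> : p * q - a * b = q * (p - a) + a * (q - b) by ring.
  by apply: gen_idealD; apply: gen_idealM.
Qed.

(** * Polynomial rings and free modules as modules with operators *)

Section PolyModules.
Variables (K : fieldType) (n : nat) (s : seq 'I_n).
Local Notation R := {mpoly K[n]}.

(** Total in k because the operators of a module are indexed by all numbers. *)
Definition var (k : nat) : R := if onth s k is Some i then 'X_i else 0.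

Lemma var_homog k : homog_of_deg 1 (var k).
Proof. by rewrite /var; case: onth => [i|]; [exact: homogX | left]. Qed.

Lemma var_lt k : (k < size s)%N -> exists2 i, onth s k = Some i & var k = 'X_i.
Proof.
rewrite /var => ks; case e: (onth s k) => [i|]; first by exists i.
by move: ks; rewrite -(onthTE s) e.
Qed.

Lemma varM_homog k t (p : R) : homog_of_deg t p -> homog_of_deg (t + 1) (var k * p).
Proof. by move=> h; rewrite addrC; apply: homogM h; apply: var_homog. Qed.

Definition poly_module : op_module.
Proof.
refine (@OpModule R (fun k p => var k * p) (@homog_of_deg K n) _ _ _ _).
- by move=> k p q; rewrite mulrBr.
- by move=> k l p; rewrite mulrCA.
- exact: homog_sub.
- exact: varM_homog.
Defined.

Section FreeModule.
Variables (r : nat) (deg : 'I_r -> int).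

Definition row_homog (t : int) (v : 'rV[R]_r) : Prop :=
  forall k, homog_of_deg (t - deg k) (v ord0 k).

(** The direct sum of the shifted modules R(- deg k). *)
Definition free_module : op_module.
Proof.
refine (@OpModule 'rV[R]_r (fun k v => var k *: v) row_homog _ _ _ _).
- by move=> k p q; rewrite scalerBr.
- by move=> k l p; rewrite !scalerA mulrC.
- move=> t; split=> [k|u v hu hv k]; rewrite !mxE; first by left.
  exact: (subgroupB (homog_sub _ _ _)).
- by move=> k t v hv l; rewrite mxE addrAC; apply: varM_homog.
Defined.

(** Division by a variable inverts multiplication by it and commutes with the
    other variables. *)
Lemma free_module_acyclic : uniq s -> acyclic free_module (size s).
Proof.
move=> us; pose q k (v : 'rV[R]_r) : 'rV[R]_r :=
  if onth s k is Some i then map_mx (pdivX i) v else 0.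
apply: (@acyclic_of_div free_module _ q) => [k|k v|k l v|k t v].
- move=> /var_lt[i e _] u v; rewrite /q e; apply/rowP => l.
  by rewrite !mxE pdivXA.
- move=> /var_lt[i e ei]; rewrite /= /q e ei; apply/rowP => l.
  by rewrite !mxE pdivXK.
- move=> /andP[lk ks]; have [i e _] := var_lt ks.
  have ls := ltn_trans lk ks; have [j ej vj] := var_lt ls.
  rewrite /= /q e vj; apply/rowP => l'; rewrite !mxE pdivX_comm //.
  apply: contraTneq lk => ij; move: e ej; rewrite -{j vj}ij => /(onth_nth i) e /(onth_nth i) e'.
  by rewrite -leqNgt leq_eqVlt -(nth_uniq i ks ls us) e e' eqxx.
- by move=> /var_lt[i e _] hv l; rewrite /q e mxE addrAC; apply: pdivX_homog.
Qed.

Lemma op_span_free m t (v : 'rV[R]_r) :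
  (forall k, @op_span poly_module m (homog_of_deg (t - deg k)) (v ord0 k)) ->
  @op_span free_module m (row_homog t) v.
Proof.
elim: m v => [|m IH] v /= hv; first by apply/rowP => k; rewrite hv mxE.
have [u hu uv] := fin_all_exists2 hv.
exists (\row_k u k) => [k|]; first by rewrite mxE.
by apply: IH => k; rewrite !mxE.
Qed.
End FreeModule.

(** Dividing by the variables in turn leaves a remainder none of whose monomials
    is divisible by a variable, that is, a constant. *)
Lemma op_span_poly t (p : R) : (forall i, i \in s) ->
  homog_of_deg t p -> p@_0%MM = 0 ->
  @op_span poly_module (size s) (homog_of_deg (t - 1)) p.
Proof.
move=> sT hp p0.
have main m : (m <= size s)%N -> forall q : R, homog_of_deg t q ->
    (forall mon, q@_mon != 0 -> exists l i,
       [/\ (l < m)%N, onth s l = Some i & mon i != 0%N]) ->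
    @op_span poly_module m (homog_of_deg (t - 1)) q.
  elim: m => [_|m IH ms] q hq qm /=.
    apply/mpolyP => mon; rewrite mcoeff0; apply/eqP/negPn/negP => /qm.
    by case=> l [i []].
  have [i ei ->] := var_lt ms.
  exists (pdivX i q); first exact: pdivX_homog.
  apply: IH; first exact: ltnW.
    apply: (subgroupB (homog_sub _ _ _)) => //; rewrite -(subrKC 1 t).
    by apply: homogM; [exact: homogX | exact: pdivX_homog].
  move=> mon; rewrite mcoeff_divX_rem; case: ifP => [/eqP mi|_]; last by rewrite eqxx.
  move=> /qm [l [j [lm ej mj]]]; exists l, j; split=> //.
  move: lm; rewrite ltnS leq_eqVlt => /orP[/eqP lm|//].
  by move: ej mj; rewrite lm ei => -[<-]; rewrite mi.
apply: main => // mon hmon.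
have [i mi] : exists i, mon i != 0%N.
  case: (pickP (fun i => mon i != 0%N)) => [i mi|h]; first by exists i.
  move: hmon; rewrite (_ : mon = 0%MM) ?p0 ?eqxx //.
  by apply/mnmP => i; rewrite mnm0E; apply/eqP/negbFE; apply: h.
have /onthP[l el] := sT i.
exists l, i; split=> //; rewrite -(onthTE s) el //.
Qed.
End PolyModules.

(** Homogeneous ideals that do not contain 1. *)
Record graded_ideal (K : fieldType) n (I : {mpoly K[n]} -> Prop) : Prop := {
  gi_submod : submodule (I : {mpoly K[n]}^o -> Prop);
  gi_comp : forall z p, I p -> I (pcomp z p);
  gi_const : forall p, I p -> p@_0%MM = 0 }.

Lemma graded_ideal_closed (K : fieldType) n (s : seq 'I_n) I :
  graded_ideal I -> op_closed (I : poly_module K s -> Prop).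
Proof.
case=> sm _ _; split=> [|k v Iv]; last exact: (@submodZ _ _ _ (var K s k) _ sm Iv).
by split=> [|u v]; [exact: sm.1 | exact: (@submodB _ _ _ _ _ sm)].
Qed.

(** * Minimal resolutions compute Koszul homology *)

Section RowComponents.
Variables (K : fieldType) (n : nat).
Local Notation R := {mpoly K[n]}.

Definition row_comp r (deg : 'I_r -> int) (t : int) (v : 'rV[R]_r) : 'rV[R]_r :=
  \row_k pcomp (t - deg k) (v ord0 k).

Lemma row_comp_homog r (deg : 'I_r -> int) t v : row_homog deg t (row_comp deg t v).
Proof. by move=> k; rewrite mxE; apply: pcomp_homog. Qed.

Lemma row_comp_id r (deg : 'I_r -> int) t v : row_homog deg t v -> row_comp deg t v = v.
Proof. by move=> h; apply/rowP => k; rewrite mxE pcomp_id. Qed.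

Lemma row_comp_mul r m (deg : 'I_r -> int) (deg' : 'I_m -> int) (D : 'M[R]_(r, m)) t v :
  (forall k l, homog_of_deg (deg k - deg' l) (D k l)) ->
  row_comp deg' t (v *m D) = row_comp deg t v *m D.
Proof.
move=> hD; apply/rowP => l; rewrite !mxE pcomp_sum; apply: eq_bigr => k _.
by rewrite mxE -(pcompM _ _ (hD k l)); congr pcomp; rewrite addrA subrK.
Qed.

Lemma row_homog_mul r m (deg : 'I_r -> int) (deg' : 'I_m -> int) (D : 'M[R]_(r, m)) t v :
  (forall k l, homog_of_deg (deg k - deg' l) (D k l)) ->
  row_homog deg t v -> row_homog deg' t (v *m D).
Proof.
move=> hD hv; rewrite -(row_comp_id hv) -(row_comp_mul _ _ hD); exact: row_comp_homog.
Qed.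
End RowComponents.

Section Link.
Variables (K : fieldType) (n : nat) (s : seq 'I_n).
Local Notation R := {mpoly K[n]}.
Variables (I : R -> Prop) (F : free_seq K n).
Hypotheses (us : uniq s) (sT : forall i, i \in s).
Hypotheses (gI : graded_ideal I) (mF : minimal_resolution I F).

Let FM q : op_module := free_module K s (@fr_deg _ _ F q).
Let Z q (v : FM q) : Prop := exists w, v = w *m fr_diff F q.
Let rF : graded_free_resolution I F := mF.1.

Let diff0 q k l : (fr_diff F q k l)@_0%MM = 0.
Proof. by apply/max_homog_idealP; apply: mF.2. Qed.

Let Z_closed q : op_closed (@Z q).
Proof.
split=> [|k _ [w ->]]; last by exists (var K s k *: w); rewrite -scalemxAl.
split=> [|_ _ [w ->] [w' ->]]; first by exists 0; rewrite mul0mx.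
by exists (w - w'); rewrite mulmxBl.
Qed.

Let row_const0 q (w : 'rV[R]_(fr_rank F q.+1)) l :
  ((w *m fr_diff F q) ord0 l)@_0%MM = 0.
Proof.
rewrite mxE raddf_sum big1 //= => k _; rewrite mcoeff0M.
by rewrite diff0 mulr0.
Qed.

Let vanish_aug i t :
  vanish (size s) (I : poly_module K s -> Prop) i t <-> vanish (size s) (@Z 0) i t.
Proof.
have hA k l : homog_of_deg (fr_deg k - (fun=> 0 : int) l) (fr_aug F k l).
  by rewrite subr0 ord1; apply: res_aug_homog rF k.
pose f (v : FM 0) : poly_module K s := (v *m fr_aug F) ord0 ord0.
symmetry; apply: (@vanish_iso _ _ _ f).
- split=> [u v|k v _|t' v hv]; first by rewrite /f mulmxBl !mxE.
    by rewrite /f /= -scalemxAl mxE.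
  by have := row_homog_mul hA hv ord0; rewrite /= subr0.
- exact: graded_ideal_closed.
- by move=> v; rewrite (res_exact0 rF v).
- move=> t' p hp; have [v hv] := res_surj rF p.
  exists (row_comp (@fr_deg _ _ F 0) t' v); first exact: row_comp_homog.
  have := gi_comp gI t' hv; rewrite pcompA pcomp_id // /f -(row_comp_mul _ _ hA).
  by rewrite [row_comp _ _ _ _ _]mxE subr0.
Qed.

Let vanish_step q (i : nat) t :
  vanish (size s) (@Z q) i.+1 t <-> vanish (size s) (@Z q.+1) i (t + 1).
Proof.
have hD := res_diff_homog rF (i := q).
apply: (@vanish_shift (FM q) (FM q.+1) _ (mulmx^~ (fr_diff F q))) => //.
- split=> [u v|k v _|t' v]; first exact: mulmxBl.
    by rewrite /= scalemxAl.
  exact: row_homog_mul.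
- exact: free_module_acyclic.
- move=> t' v hv [w hw]; exists (row_comp (@fr_deg _ _ F q.+1) t' w).
    exact: row_comp_homog.
  by rewrite -(row_comp_mul _ _ hD) -hw row_comp_id.
- by move=> w; exists w.
- by move=> w; rewrite (res_exact rF w).
- move=> t' w hw; apply: (op_span_free (t := t' - 1)) => k.
  rewrite addrAC; apply: op_span_poly => //.
    exact: (row_homog_mul hD hw k).
Qed.

Let vanish_all q (i : nat) t :
  vanish (size s) (@Z q) i t <-> vanish (size s) (@Z (q + i)) 0 (t + i%:Z).
Proof.
elim: i q t => [|i IH] q t; first by rewrite addn0 addr0.
rewrite vanish_step IH addSnnS; suff -> : t + 1 + i%:Z = t + i.+1%:Z by [].
lia.
Qed.

(* In homological degree 0 the Koszul homology is the quotient by the variables,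
   and minimality makes that of the syzygy module a space with one basis vector
   for each generator. *)
Let vanish_bottom q t :
  vanish (size s) (@Z q) 0 t <-> ~ exists k, @fr_deg _ _ F q k = t.
Proof.
split=> [h [k kt]|h c hc _].
  pose v : 'rV[R]_(fr_rank F q) := delta_mx ord0 k.
  pose Q (w : FM q) := forall l, (w ord0 l)@_0%MM = 0.
  have hQ : subgroup Q.
    split=> [l|u w hu hw l]; first by rewrite mxE mcoeff0.
    by rewrite !mxE mcoeffB hu hw subrr.
  have hv : row_homog (@fr_deg _ _ F q) t v.
    move=> l; rewrite mxE eqxx /=; have [->|] := eqVneq l k; last by left.
    by rewrite kt subrr -mpolyC1; apply: homogC.
  have [||b [hb db]] := h (@kconst (FM q) (size s) v).
  - by apply/kin_const => //; apply: (subgroup0 (@hom_sub (FM q) t)).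
  - rewrite kdiff_const; apply: (subgroup0 (kin_sub _ _ (Z_closed q).1)).
  have : kin Q 0 (@kconst (FM q) (size s) v).
    apply: (subgroup_congr (kin_sub _ _ hQ) (v := kdiff (@op (FM q)) b)).
      by apply: kin_imp db => _ [w ->] l; apply: row_const0.
    rewrite -(subrr 1); apply: (kin_diff hQ _ _ hb) => [m w _ hw l|m _].
      rewrite mxE mcoeff0M; suff -> : (var K s m)@_0%MM = 0 by rewrite mul0r.
      by apply: (homog_coeff0 (var_homog K s m)); rewrite mdeg0.
    by rewrite /= scaler0.
  rewrite kin_const; last exact: (subgroup0 hQ).
  by move=> /(_ k) /eqP; rewrite mxE !eqxx mcoeff1 eqxx oner_eq0.
have [v hv ->] := kin0P hc.
have [||b hb eb] := @op_span_boundary (FM q) (size s) (row_homog (@fr_deg _ _ F q) (t - 1)) v.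
- exact: (subgroup0 (@hom_sub (FM q) (t - 1))).
- apply: op_span_free => k; rewrite addrAC; apply: op_span_poly => //.
  apply: homog_coeff0 (hv k) _; rewrite mdeg0 eq_sym subr_eq0.
  by apply/eqP => tk; apply: h; exists k.
exists b; split=> //; rewrite eb subrr.
exact: (subgroup0 (kin_sub _ _ (Z_closed q).1)).
Qed.

(** The symmetry of Tor: the dimension shift along the resolution moves the
    Koszul homology of the quotient down to degree 0 of the i-th syzygy module,
    where by minimality exactly the generators are left. *)
Lemma resolution_degP (i : nat) j :
  (exists k, @fr_deg _ _ F i k = j) <->
  ~ vanish (size s) (I : poly_module K s -> Prop) i (j - i%:Z).
Proof.
rewrite vanish_aug vanish_all add0n subrK vanish_bottom.
by split=> [h nh|/NNPP//]; exact: nh h.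
Qed.
End Link.

(** * Existence of minimal graded resolutions *)

Lemma lspan_mulmx (A : comNzRingType) r (t : seq 'rV[A]_r) v :
  lspan t v -> exists w : 'rV_(size t), v = w *m \matrix_(i < size t) t`_i.
Proof.
have sum_row (w : 'rV_(size t)) :
    w *m \matrix_(i < size t) t`_i = \sum_i w ord0 i *: t`_i.
  by rewrite mulmx_sum_row; apply: eq_bigr => i _; rewrite rowK.
suff h : lspan t v -> exists a : nat -> A, v = \sum_(i < size t) a i *: t`_i.
  by move=> /h [a ->]; exists (\row_i a i); rewrite sum_row; apply: eq_bigr => i _; rewrite mxE.
elim: t v {sum_row} => [|x t IH] v /=.
  by move=> ->; exists (fun=> 0); rewrite big_ord0.
move=> [a /IH [b hb]]; exists (fun i => if i is i'.+1 then b i' else a).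
by rewrite big_ord_recl /= -hb addrC subrK.
Qed.

Lemma least_nat (P : nat -> Prop) :
  (exists n, P n) -> exists n, P n /\ forall m, P m -> (n <= m)%N.
Proof.
move=> [n]; elim/ltn_ind: n => n IH Pn.
case: (classic (exists m, P m /\ (m < n)%N)) => [[m [Pm /IH]]|h]; first exact.
exists n; split=> // m Pm; rewrite leqNgt; apply/negP => mn; apply: h; by exists m.
Qed.

Section MinimalGenerators.
Variables (K : fieldType) (n : nat).
Local Notation R := {mpoly K[n]}.

Definition homog_generators r (deg : 'I_r -> int) (N : 'rV[R]_r -> Prop)
    m (deg' : 'I_m -> int) (D : 'M[R]_(m, r)) : Prop :=
  (forall k l, homog_of_deg (deg' k - deg l) (D k l)) /\
  (forall v, N v <-> exists w, v = w *m D).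

Variables (r : nat) (deg : 'I_r -> int) (N : 'rV[R]_r -> Prop).
Hypothesis hN : submodule N.
Hypothesis gN : forall t v, N v -> N (row_comp deg t v).

Lemma row_comp_partition (v : 'rV[R]_r) : exists zs : seq int, v = \sum_(z <- zs) row_comp deg z v.
Proof.
pose B := \max_(k < r) msize (v ord0 k).
pose zs := undup [seq (d%:Z + deg k : int) | d <- iota 0 B, k <- enum 'I_r].
exists zs; apply/rowP => k; rewrite summxE; apply/mpolyP => m.
rewrite raddf_sum /= (eq_bigr (fun z => if (mdeg m)%:Z == z - deg k then
    (v ord0 k)@_m else 0)) => [|z _]; last by rewrite mxE mcoeff_pcomp.
have [v0|vm] := eqVneq (v ord0 k)@_m 0.
  by rewrite v0 big1 // => z _; rewrite if_same.
pose z0 := (mdeg m)%:Z + deg k.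
rewrite (bigD1_seq z0) ?undup_uniq //=; last first.
  rewrite mem_undup; apply/allpairsP; exists (mdeg m, k); split=> //=; last by rewrite mem_enum.
  rewrite mem_iota /= add0n; apply: leq_trans (leq_bigmax k).
  by apply: msize_mdeg_lt; rewrite mcoeff_msupp.
rewrite addrK eqxx big1 ?addr0 // => z zz0; case: eqP => // e.
by case/eqP: zz0; rewrite /z0 e subrK.
Qed.

Lemma exists_homog_generators : exists m (deg' : 'I_m -> int) (D : 'M[R]_(m, r)),
  homog_generators deg N deg' D.
Proof.
have [t ht] := noetherian_rV (@noetherian_mpoly K n) hN.
have [gl [hgl Ngl]] : exists gl : seq (int * 'rV[R]_r),
    (forall g, g \in gl -> row_homog deg g.1 g.2 /\ N g.2) /\
    (forall x, x \in t -> lspan (map snd gl) x).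
  have {ht} : forall x, x \in t -> N x by move=> x /mem_lspan /ht.
  elim: t => [|x t IH] Nt; first by exists [::].
  case: IH => [y yt|gl [h1 h2]]; first by apply: Nt; rewrite inE yt orbT.
  have Nx := Nt x (mem_head _ _); have [zs ezs] := row_comp_partition x.
  exists ([seq (z, row_comp deg z x) | z <- zs] ++ gl); split=> [g|y].
    rewrite mem_cat => /orP[/mapP[z _ ->]|/h1//].
    by split; [apply: row_comp_homog | apply: gN].
  rewrite map_cat inE => /orP[/eqP->|/h2]; last first.
    apply: lspan_sub => [|z zs']; first exact: lspan_submod.
    by apply: mem_lspan; rewrite mem_cat zs' orbT.
  rewrite [X in lspan _ X]ezs -map_comp; set T := _ ++ _.
  have smT := lspan_submod T.
  rewrite big_seq; apply: (big_ind (lspan T)) => [|u w|z zzs].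
  - exact: smT.1.
  - exact: submodD.
  by apply: mem_lspan; rewrite mem_cat; apply/orP; left; apply/mapP; exists z.
set t' := map snd gl.
exists (size t'), (fun i => nth 0 (map fst gl) i), (\matrix_(i < size t') t'`_i).
have gl_i (i : 'I_(size t')) : (nth 0 (map fst gl) i, t'`_i) \in gl.
  have il : (i < size gl)%N by rewrite -(size_map snd) ltn_ord.
  rewrite /t' !(nth_map (0, 0)) //.
  by rewrite -surjective_pairing; apply: mem_nth.
split=> [k l|v]; first by rewrite mxE; apply: (hgl _ (gl_i k)).1.
split=> [/ht|[w ->]].
  move=> h; apply: lspan_mulmx; apply: lspan_sub h => //; exact: lspan_submod.
rewrite mulmx_sum_row; apply: (big_ind N) => [|u u'|i _].
- exact: hN.1.
- exact: submodD.
- by apply: submodZ => //; rewrite rowK; apply: (hgl _ (gl_i i)).2.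
Qed.

(** In a generating set of least size no relation has a unit coefficient, since
    it would express one generator through the others. *)
Lemma exists_minimal_generators :
  exists m (deg' : 'I_m -> int) (D : 'M[R]_(m, r)), homog_generators deg N deg' D /\
    forall w : 'rV[R]_m, w *m D = 0 -> forall k, (w ord0 k)@_0%MM = 0.
Proof.
have [m [[deg' [D hD]] min]] := least_nat exists_homog_generators.
exists m, deg', D; split=> // w wD k; apply/eqP/negPn/negP => c0.
have [hdeg hgen] := hD.
(* The component of this degree has the constant of w at k as its k-th entry. *)
pose w' := row_comp deg' (deg' k) w.
have w'D : w' *m D = 0.
  rewrite -(row_comp_mul _ _ hdeg) wD; apply/rowP => l.
  by rewrite !mxE (zmorph0 (@pcompA _ _ _)).
pose c := (w ord0 k)@_0%MM.
have w'k : w' ord0 k = c%:MP.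
  apply/mpolyP => mon; rewrite mxE subrr mcoeff_pcomp mcoeffC eqz_nat mdeg_eq0.
  by case: eqVneq => [->|]; rewrite ?mulr1 ?mulr0.
case: m k deg' D hD min w wD c0 hdeg hgen @w' w'D @c w'k => [[]//|m].
move=> k deg' D hD min w wD c0 hdeg hgen w' w'D c w'k.
have : (m.+1 <= m)%N; last by rewrite ltnn.
apply: min; exists (deg' \o lift k), (row' k D); split=> [i j|v].
  by rewrite mxE; apply: hdeg.
have sumD (u : 'rV[R]_m.+1) : u *m D =
    u ord0 k *: row k D + (col' k u) *m row' k D.
  rewrite mulmx_sum_row (bigD1_ord k) //=; congr (_ + _).
  rewrite mulmx_sum_row; apply: eq_bigr => i _.
  by rewrite mxE; congr (_ *: _); apply/rowP => j; rewrite !mxE.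
rewrite hgen; split=> [[u ->]|[u ->]]; last first.
  exists (\row_i if unlift k i is Some j then u ord0 j else 0).
  rewrite sumD mxE unlift_none scale0r add0r; congr (_ *m _).
  by apply/rowP => j; rewrite !mxE liftK.
have rk : row k D = - (c^-1)%:MP *: (col' k w' *m row' k D).
  move: w'D; rewrite sumD w'k => /eqP; rewrite addr_eq0 => /eqP e.
  rewrite scaleNr -scalerN -e scalerA -mpolyCM mulVf // mpolyC1 scale1r //.
exists (col' k u - (u ord0 k * (c^-1)%:MP) *: col' k w').
by rewrite sumD rk mulmxBl scalerA -scalemxAl mulrN scaleNr addrC.
Qed.
End MinimalGenerators.

Section Existence.
Variables (K : fieldType) (n : nat).
Local Notation R := {mpoly K[n]}.

(** The syzygies to be covered next. The last field, that no entry has a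
    constant term, is the minimality of the matrix that covers them. *)
Record stage := Stage {
  st_rank : nat;
  st_deg : 'I_st_rank -> int;
  st_mem : 'rV[R]_st_rank -> Prop;
  st_submod : submodule st_mem;
  st_comp : forall t v, st_mem v -> st_mem (row_comp st_deg t v);
  st_const : forall v, st_mem v -> forall k, (v ord0 k)@_0%MM = 0 }.

Definition covers (S : stage) (TD : {T : stage & 'M[R]_(st_rank T, st_rank S)}) :=
  homog_generators (@st_deg S) (@st_mem S) (@st_deg (tag TD)) (tagged TD) /\
  (forall w, st_mem w <-> w *m tagged TD = 0).

Lemma exists_cover (S : stage) : exists TD, @covers S TD.
Proof.
have [m [deg [D [hD kD]]]] := exists_minimal_generators (st_submod S) (@st_comp S).
have ker_sub : submodule (fun w : 'rV[R]_m => w *m D = 0).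
  split=> [|a u v hu hv]; first by rewrite mul0mx.
  by rewrite mulmxDl -scalemxAl hu hv scaler0 addr0.
have ker_comp t (w : 'rV[R]_m) : w *m D = 0 -> row_comp deg t w *m D = 0.
  move=> wD; rewrite -(row_comp_mul _ _ hD.1) wD; apply/rowP => l.
  by rewrite !mxE (zmorph0 (@pcompA _ _ _)).
by exists (Tagged (fun T => 'M[R]_(st_rank T, st_rank S)) (i := Stage ker_sub ker_comp kD) D).
Qed.

Definition next_stage (S : stage) : stage :=
  tag (proj1_sig (constructive_indefinite_description _ (exists_cover S))).

Definition next_diff (S : stage) : 'M[R]_(st_rank (next_stage S), st_rank S) :=
  tagged (proj1_sig (constructive_indefinite_description _ (exists_cover S))).

Lemma next_diffP (S : stage) :
  homog_generators (@st_deg S) (@st_mem S) (@st_deg (next_stage S)) (next_diff S) /\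
  (forall w, st_mem w <-> w *m next_diff S = 0).
Proof. exact: (proj2_sig (constructive_indefinite_description _ (exists_cover S))). Qed.

Variables (I : R -> Prop) (gI : graded_ideal I).

Lemma exists_minimal_resolution : exists F, minimal_resolution I F.
Proof.
pose N0 (v : 'rV[R]_1) := I (v ord0 ord0).
have sub0 : submodule N0.
  have [I0 Il] := gi_submod gI.
  by split=> [|a u v hu hv]; rewrite /N0 !mxE //; apply: Il.
have comp0 t v : N0 v -> N0 (row_comp (fun=> 0) t v).
  by move=> hv; rewrite /N0 mxE; apply: gi_comp.
have const0 v : N0 v -> forall k, (v ord0 k)@_0%MM = 0.
  by move=> hv k; rewrite (ord1 k); apply: gi_const hv.
pose st i := iter i next_stage (Stage sub0 comp0 const0).
pose F := @FreeSeq K n (fun i => st_rank (st i)) (fun i => @st_deg (st i))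
  (const_mx 1 : 'cV[R]_1) (fun i => next_diff (st i)).
have aug (v : 'rV[R]_1) : (v *m (const_mx 1 : 'cV[R]_1)) ord0 ord0 = v ord0 ord0.
  by rewrite mxE big_ord1 mxE mulr1.
have hst i := (next_diffP (st i)).
exists F; split; [split=> /= |] => [k|i k l|p|v|i v|i k l].
- by rewrite mxE; right; exists 0%N; split=> //; apply: dhomog1.
- by have [[h _] _] := hst i; apply: h.
- exists (const_mx p); rewrite aug mxE subrr; exact: (gi_submod gI).1.
- by rewrite aug; have [[_ h] _] := hst 0%N; rewrite -h.
- by have [_ h] := hst i; rewrite -h; have [[_ h'] _] := hst i.+1; rewrite -h'.
- apply/max_homog_idealP => /=.
  have [[_ h] _] := hst i.
  have : st_mem (row k (next_diff (st i))) by apply/h; exists (delta_mx 0 k); rewrite rowE.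
  by move=> /st_const /(_ l); rewrite mxE.
Qed.

Lemma min_resP : minimal_resolution I (min_res I).
Proof. exact: epsilon_spec exists_minimal_resolution. Qed.
End Existence.

(** * Regularity through Koszul homology *)

Lemma max_of_seq (s : seq int) : s != [::] -> exists2 r, r \in s & forall x, x \in s -> x <= r.
Proof.
elim: s => // x s IH _; case: (eqVneq s [::]) => [->|/IH [r rs hr]].
  by exists x; rewrite ?mem_head // => y; rewrite inE => /eqP ->.
have [xr|rx] := leP x r.
  exists r => [|y]; rewrite inE ?rs ?orbT // => /orP[/eqP->//|/hr//].
exists x => [|y]; first exact: mem_head.
rewrite inE => /orP[/eqP->//|/hr yr]; exact: le_trans yr (ltW rx).
Qed.

Section Regularity.
Variables (K : fieldType) (n : nat) (I : {mpoly K[n]} -> Prop).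
Hypothesis gI : graded_ideal I.

Lemma betti_neq0 (s : seq 'I_n) (i : nat) j : uniq s -> (forall i, i \in s) ->
  betti I i j <> 0%N <-> ~ vanish (size s) (I : poly_module K s -> Prop) i (j - i%:Z).
Proof.
move=> us sT; rewrite -(resolution_degP us sT gI (min_resP gI)) /betti.
split=> [/eqP|[k kj]]; first by rewrite cards_eq0 => /set0Pn[k]; rewrite inE => /eqP; exists k.
by apply/eqP; rewrite cards_eq0; apply/set0Pn; exists k; rewrite inE kj.
Qed.

Lemma not_vanish00 (s : seq 'I_n) :
  ~ vanish (size s) (I : poly_module K s -> Prop) 0 0.
Proof.
have Ic := graded_ideal_closed s gI.
move=> h; have [||b [hb db]] := h (@kconst (poly_module K s) (size s) 1).
- apply/kin_const; first exact: (subgroup0 (homog_sub _ _ _)).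
  by rewrite -mpolyC1; apply: homogC.
- by rewrite kdiff_const; apply: (subgroup0 (kin_sub _ _ Ic.1)).
have hb0 : b = 0.
  apply: (@kin_all0 _ _ (0 + 1)); apply: kin_imp hb => v; exact: homog_neg.
move: db; rewrite hb0 kdiff0 subr0 kin_const; last exact: Ic.1.1.
by move=> /(gi_const gI) /eqP; rewrite mcoeff1 eqxx oner_eq0.
Qed.

(** The maximum exists since each module of the resolution has finitely many
    generators and the Koszul complex is as long as the number of variables. *)
Lemma reg_quotP : is_reg I (reg_quot I).
Proof.
apply: epsilon_spec; set F := min_res I.
pose s := enum 'I_n.
have us : uniq s by apply: enum_uniq.
have sT (i : 'I_n) : i \in s by rewrite mem_enum.
have bP := fun i j => @betti_neq0 s i j us sT.
have degP (i : nat) j : betti I i j <> 0%N <-> exists k, @fr_deg _ _ F i k = j.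
  by rewrite bP -(resolution_degP us sT gI (min_resP gI)).
pose vals := [seq fr_deg k - i%:Z | i <- iota 0 (size s).+1, k <- enum 'I_(fr_rank F i)].
have valsP x : x \in vals <-> exists i j, betti I i j <> 0%N /\ x = j - i%:Z.
  split=> [/allpairsPdep[i [k [_ _ ->]]]|[i [j [hb ->]]]].
    by exists i, (fr_deg k); split=> //; apply/degP; exists k.
  have [k kj] := (degP i j).1 hb.
  apply/allpairsPdep; exists i, k; split; rewrite ?mem_enum ?kj //.
  rewrite mem_iota /= add0n ltnS leqNgt; apply/negP => si.
  apply: ((bP i j).1 hb) => c hc _; exists 0; rewrite (kin_gt _ hc) ?ltz_nat //.
  split; first exact: (subgroup0 (kin_sub _ _ (homog_sub _ _ _))).
  rewrite kdiff0 subrr; exact: (subgroup0 (kin_sub _ _ (graded_ideal_closed s gI).1)).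
have v0 : vals != [::].
  have : (0 : int) \in vals; last by apply: contraTneq => ->.
  apply/valsP; exists 0%N, 0; split=> //; apply/bP; exact: not_vanish00.
have [r /valsP [i [j [hb rij]]] rmax] := max_of_seq v0.
exists r; split; first by exists i, j.
by move=> i' j' hb'; apply: rmax; apply/valsP; exists i', j'.
Qed.

(** Every enumeration s of the variables gives the same criterion, because the
    minimal resolution does not involve one; comparisons with different subgraphs
    can thus each use the order that suits them. *)
Lemma reg_quot_le (s : seq 'I_n) r : uniq s -> (forall i, i \in s) ->
  (reg_quot I <= r) <->
  forall t, r < t -> forall i, vanish (size s) (I : poly_module K s -> Prop) i t.
Proof.
move=> us sT; have [[i [j [hb e]]] hmax] := reg_quotP.
have bP := fun i j => @betti_neq0 s i j us sT.
split=> [hr t rt [k|k]|h].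
- apply: NNPP; rewrite -[t](addrK k%:Z) => /bP /hmax; rewrite addrK => hk.
  by have := le_trans hk hr; rewrite leNgt rt.
- move=> c hc _; exists 0; rewrite (kin_lt0 _ hc) //.
  split; first exact: (subgroup0 (kin_sub _ _ (homog_sub _ _ _))).
  rewrite kdiff0 subrr; exact: (subgroup0 (kin_sub _ _ (graded_ideal_closed s gI).1)).
- rewrite e leNgt; apply/negP => hr; exact: ((bP i j).1 hb) (h _ hr i).
Qed.

Lemma reg_quot_ge0 : 0 <= reg_quot I.
Proof.
have us : uniq (enum 'I_n) by apply: enum_uniq.
have sT (i : 'I_n) : i \in enum 'I_n by rewrite mem_enum.
rewrite leNgt; apply/negP => h0.
by have /(reg_quot_le _ us sT) h := lexx (reg_quot I); apply: not_vanish00 (h 0 h0 0).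
Qed.
End Regularity.

Lemma vanish_eq (M : op_module) n (N N' : M -> Prop) i t :
  (forall v, N v <-> N' v) -> vanish n N i t <-> vanish n N' i t.
Proof.
move=> e; have kN m j (c : kchain M m) : kin N j c <-> kin N' j c.
  by split; apply: kin_imp => v /e.
split=> h c hc /kN dc; have [b [hb /kN db]] := h c hc dc; by exists b.
Qed.

(** * Linear substitutions *)

Section Substitution.
Variables (K : fieldType) (m n : nat) (h : 'I_m -> {mpoly K[n]}).
Hypothesis h1 : forall i, homog_of_deg 1 (h i).

Definition subst (p : {mpoly K[m]}) : {mpoly K[n]} := p \mPo [tuple h i | i < m].

Lemma substC c : subst c%:MP = c%:MP. Proof. exact: comp_mpolyC. Qed.
Lemma substX i : subst 'X_i = h i.
Proof. by rewrite /subst comp_mpolyXU -tnth_nth tnth_mktuple. Qed.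
Lemma substD : {morph subst : p q / p + q}. Proof. exact: comp_mpolyD. Qed.
Lemma substM : {morph subst : p q / p * q}. Proof. by move=> p q; apply: rmorphM. Qed.
Lemma substA : zmorph subst. Proof. exact: comp_mpolyB. Qed.

Lemma subst_homog z p : homog_of_deg z p -> homog_of_deg z (subst p).
Proof.
move=> hp; rewrite /subst comp_mpolyE big_seq.
apply: (big_ind (homog_of_deg z)) => [|q q'|mon].
- by left.
- exact: (subgroupD (homog_sub _ _ _)).
rewrite mcoeff_msupp => /(proj1 (homog_of_degP _ _) hp) <-.
rewrite -mul_mpolyC -[(mdeg mon)%:Z]add0r; apply: homogM; first exact: homogC.
rewrite mdegE; elim/big_rec2: _ => [|i d q _ hq]; first by rewrite -mpolyC1; apply: homogC.
rewrite PoszD; apply: homogM hq; rewrite tnth_mktuple.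
elim: (mon i) => [|k IH]; first by rewrite expr0 -mpolyC1; apply: homogC.
by rewrite exprS -[k.+1]add1n PoszD; apply: homogM.
Qed.

Lemma pcomp_subst z p : pcomp z (subst p) = subst (pcomp z p).
Proof.
have s_sum k (F : 'I_k -> {mpoly K[m]}) : subst (\sum_i F i) = \sum_i subst (F i).
  by apply: (big_morph _ substD); apply: (zmorph0 substA).
rewrite {1 2}[p]pcomp_partition s_sum !pcomp_sum s_sum.
apply: eq_bigr => i _; have hi := pcomp_homog i p.
have [<-|zi] := eqVneq (i : int) z.
  by rewrite (pcomp_id hi) (pcomp_id (subst_homog hi)).
by rewrite (pcomp_ne zi hi) (pcomp_ne zi (subst_homog hi)) (zmorph0 substA).
Qed.

Lemma mcoeff0_subst p : (subst p)@_0%MM = p@_0%MM.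
Proof.
elim/mpoly_ind: p => [c|i|p q hp hq|p q hp hq].
- by rewrite substC !mcoeffC !eqxx.
- by rewrite substX mcoeffX mnm1_eq0; apply: homog_coeff0 (h1 i) _; rewrite mdeg0.
- by rewrite substD !mcoeffD hp hq.
- by rewrite substM !mcoeff0M hp hq.
Qed.
End Substitution.

Lemma mpoly_indX (A : comNzRingType) n (Q : {mpoly A[n]} -> Prop) :
  (forall c, Q c%:MP) -> (forall c p, Q p -> Q (c%:MP * p)) ->
  (forall p q, Q p -> Q q -> Q (p + q)) ->
  (forall i p, Q p -> Q ('X_i * p)) -> forall p, Q p.
Proof.
move=> QC QZ QD QX p; rewrite -[p]mulr1.
have : Q 1 by rewrite -mpolyC1.
elim/mpoly_ind: p (1) => [c|i|p q hp hq|p q hp hq] r hr.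
- exact: QZ.
- exact: QX.
- by rewrite mulrDl; apply: QD; [apply: hp | apply: hq].
- by rewrite -mulrA; apply: hp; apply: hq.
Qed.

(** * Edge ideals *)

Section EdgeIdeal.
Variables (K : fieldType) (G : sgraph).
Local Notation S := {mpoly K[#|G|]}.
Local Notation I := (@edge_ideal K G).

Definition vertex_var (u : G) : S := 'X_(enum_rank u).

Lemma edge_ideal_edge u v : edge u v -> I (vertex_var u * vertex_var v).
Proof. by move=> uv; apply: gen_ideal_gen; exists u, v. Qed.

Lemma pcomp_edge_ideal z p : I p -> exists m (a s : 'I_m -> S),
  (forall i, exists u v : G, edge u v /\ s i = vertex_var u * vertex_var v) /\
  pcomp z p = \sum_(i < m) pcomp (z - 2) (a i) * s i.
Proof.
move=> [m [a [s [hs ->]]]]; exists m, a, s; split=> //.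
rewrite pcomp_sum; apply: eq_bigr => i _; have [u [v [_ ->]]] := hs i.
rewrite -{1}(subrK 2 z); apply: pcompM.
by apply: (@homogM _ _ 1 1); apply: homogX.
Qed.

Lemma edge_ideal_graded : graded_ideal I.
Proof.
split; first exact: gen_ideal_submod.
- move=> z p /(pcomp_edge_ideal z) [m [a [s [hs ->]]]].
  by exists m, (fun i => pcomp (z - 2) (a i)), s.
- move=> p [m [a [s [hs ->]]]]; rewrite raddf_sum big1 // => i _.
  have [u [v [_ ->]]] := hs i; rewrite /= !mcoeff0M mcoeffX mnm1_eq0.
  by rewrite mul0r mulr0.
Qed.

Lemma edge_ideal_no_linear p : I p -> homog_of_deg 1 p -> p = 0.
Proof.
move=> /(pcomp_edge_ideal 1) [m [a [s [_ e]]]] /pcomp_id <-.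
by rewrite e big1 // => i _; rewrite mul0r.
Qed.

(** The quadric of an edge, written as the boundary of a chain, is a cycle over
    the quotient; it does not bound since the ideal has no linear forms. *)
Lemma reg_edge u v : @edge G u v -> 0 < reg_quot I.
Proof.
move=> uv; have gI := edge_ideal_graded.
have us : uniq (enum 'I_#|G|) by apply: enum_uniq.
have sT (i : 'I_#|G|) : i \in enum 'I_#|G| by rewrite mem_enum.
rewrite ltNge; apply/negP => /(reg_quot_le gI _ us sT) /(_ 1 isT 1) h.
set s := enum 'I_#|G| in us sT h; set M := poly_module K s in h.
pose p : M := vertex_var u * vertex_var v.
have Ip : I p by apply: edge_ideal_edge.
have hp : homog_of_deg 2 (p : S) by apply: (@homogM _ _ 1 1); apply: homogX.
have Ic := graded_ideal_closed s gI.
have sp := op_span_poly sT hp (gi_const gI Ip).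
have [c hc dc] := op_span_boundary (subgroup0 (homog_sub _ _ _)) sp.
have [||b [hb db]] := h c; first exact: hc.
  by rewrite -dc subrr; apply/kin_const; [exact: Ic.1.1 | exact: Ip].
have cb : c = kdiff (@op M) b.
  apply/eqP; rewrite -subr_eq0; apply/eqP; apply: (@kin_all0 _ _ 1).
  have hcb : kin (@homog_of_deg K #|G| 1) 1 (c - kdiff (@op M) b).
    apply: (subgroupB (kin_sub _ _ (homog_sub _ _ _))); first exact: hc.
    exact: (@kin_diff_hom M).
  by apply: kin_imp (kin_and hcb db) => w [hw Iw]; apply: edge_ideal_no_linear.
move: dc; rewrite cb kdiff_diff => p0.
have : kin (fun w : M => w = 0) 0 (@kconst M (size s) p).
  by rewrite p0; apply: (subgroup0 (kin_sub _ _ (subgroup_eq0 _))).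
rewrite kin_const // /p /vertex_var -mpolyXD => /mpolyP /(_ (U_(enum_rank u) + U_(enum_rank v))%MM).
by rewrite mcoeffX eqxx mcoeff0 => /eqP; rewrite oner_eq0.
Qed.
End EdgeIdeal.

(** * Induced subgraphs *)

Section InducedSubgraph.
Variables (K : fieldType) (G P : sgraph) (f : G -> P).
Hypotheses (f_inj : injective f) (f_edge : forall u v, edge (f u) (f v) = edge u v).
Local Notation S := {mpoly K[#|G|]}.
Local Notation R := {mpoly K[#|P|]}.
Local Notation IG := (@edge_ideal K G).
Local Notation IP := (@edge_ideal K P).

Definition incl : S -> R := subst (fun i : 'I_#|G| => vertex_var K (f (enum_val i))).

Definition restr : R -> S :=
  subst (fun j : 'I_#|P| => if [pick u | f u == enum_val j] is Some u then vertex_var K u else 0).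

Let h_incl (i : 'I_#|G|) : homog_of_deg 1 (vertex_var K (f (enum_val i))).
Proof. exact: homogX. Qed.

Let h_restr (j : 'I_#|P|) : homog_of_deg 1
  (if [pick u | f u == enum_val j] is Some u then vertex_var K u else 0).
Proof. by case: pickP => [u _|_]; [exact: homogX | left]. Qed.

Lemma inclC c : incl c%:MP = c%:MP. Proof. exact: substC. Qed.
Lemma inclD : {morph incl : p q / p + q}. Proof. exact: substD. Qed.
Lemma inclM : {morph incl : p q / p * q}. Proof. exact: substM. Qed.
Lemma inclA : zmorph incl. Proof. exact: substA. Qed.
Lemma incl0 : incl 0 = 0. Proof. exact: (zmorph0 inclA). Qed.
Lemma incl_homog z p : homog_of_deg z p -> homog_of_deg z (incl p).
Proof. exact: subst_homog. Qed.

Lemma restrC c : restr c%:MP = c%:MP. Proof. exact: substC. Qed.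
Lemma restrD : {morph restr : p q / p + q}. Proof. exact: substD. Qed.
Lemma restrM : {morph restr : p q / p * q}. Proof. exact: substM. Qed.
Lemma restrA : zmorph restr. Proof. exact: substA. Qed.
Lemma restr0 : restr 0 = 0. Proof. exact: (zmorph0 restrA). Qed.
Lemma restr_homog z p : homog_of_deg z p -> homog_of_deg z (restr p).
Proof. exact: subst_homog. Qed.
Lemma mcoeff0_restr p : (restr p)@_0%MM = p@_0%MM.
Proof. exact: mcoeff0_subst. Qed.

Lemma incl_var u : incl (vertex_var K u) = vertex_var K (f u).
Proof. by rewrite /incl substX enum_rankK. Qed.

Lemma restr_var u : restr (vertex_var K (f u)) = vertex_var K u.
Proof.
rewrite /restr substX enum_rankK; case: pickP => [v /eqP/f_inj -> //|/(_ u)].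
by rewrite eqxx.
Qed.

Lemma restr_var0 a : a \notin codom f -> restr (vertex_var K a) = 0.
Proof.
move=> fa; rewrite /restr substX enum_rankK; case: pickP => // u /eqP e.
by case/negP: fa; rewrite -e codom_f.
Qed.

Lemma vertex_var_val (Q : sgraph) (i : 'I_#|Q|) : 'X_i = vertex_var K (enum_val i).
Proof. by rewrite /vertex_var enum_valK. Qed.

Lemma inclK : cancel incl restr.
Proof.
elim/mpoly_ind => [c|i|p q hp hq|p q hp hq].
- by rewrite inclC restrC.
- by rewrite vertex_var_val incl_var restr_var.
- by rewrite inclD restrD hp hq.
- by rewrite inclM restrM hp hq.
Qed.

Lemma incl_edge_ideal p : IG p -> IP (incl p).
Proof.
apply: (@gen_ideal_min _ _ (fun p => IP (incl p))) => [|q r hq hr|q r hr|_ [u [v [uv ->]]]].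
- rewrite incl0; exact: gen_ideal0.
- by rewrite inclD; apply: gen_idealD.
- by rewrite inclM; apply: gen_idealM.
- rewrite -!/(vertex_var K _) inclM !incl_var.
  by apply: edge_ideal_edge; rewrite f_edge.
Qed.

(** The ideal generated by the edges of G and the vertices outside G; as a
    preimage, its quotient is visibly that of the edge ideal of G. *)
Definition pull_ideal (p : R) : Prop := IG (restr p).

Lemma pull_ideal_graded : graded_ideal pull_ideal.
Proof.
have [sm cm ct] := @edge_ideal_graded K G; split.
- split=> [|a u v hu hv]; rewrite /pull_ideal.
    by rewrite restr0; exact: sm.1.
  by rewrite restrD restrM; apply: (sm.2).
- by move=> z p; rewrite /pull_ideal /restr -pcomp_subst //; apply: cm.
- by move=> p /ct; rewrite mcoeff0_restr.
Qed.

Lemma edge_ideal_pull p : IP p -> pull_ideal p.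
Proof.
have [sm _ _] := pull_ideal_graded.
apply: (@gen_ideal_min _ _ pull_ideal) => [|q r|q r hr|_ [a [b [ab ->]]]].
- exact: sm.1.
- exact: (@submodD _ _ _ _ _ sm).
- exact: (@submodZ R R^o pull_ideal q r sm hr).
rewrite -!/(vertex_var K _) /pull_ideal restrM.
have I0 : IG 0 by apply: gen_ideal0.
have [/codomP[u ea]|na] := boolP (a \in codom f); last by rewrite restr_var0 // mul0r.
have [/codomP[v eb]|nb] := boolP (b \in codom f); last by rewrite [X in _ * X]restr_var0 // mulr0.
by rewrite ea eb !restr_var; apply: edge_ideal_edge; rewrite -f_edge -ea -eb.
Qed.

(** The factor p - incl (restr p) lies in the ideal of the vertices outside G, and
    each of those forms an edge with w. *)
Lemma cone_vertex_mul w : (forall a, a \notin codom f -> edge w a) ->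
  forall p, IP (vertex_var K w * (p - incl (restr p))).
Proof.
move=> hw; elim/mpoly_indX => [c|c p hp|p q hp hq|i p hp].
- rewrite restrC inclC subrr mulr0; exact: gen_ideal0.
- rewrite restrM restrC inclM inclC -mulrBr mulrCA.
  exact: gen_idealM.
- rewrite restrD inclD opprD addrACA mulrDr.
  exact: (gen_idealD hp hq).
- rewrite restrM inclM vertex_var_val.
  have [/codomP[u ->]|na] := boolP (enum_val i \in codom f).
    by rewrite restr_var incl_var -mulrBr mulrCA; apply: gen_idealM.
  rewrite restr_var0 // incl0 mul0r subr0 mulrA mulrC.
  by apply: gen_idealM; apply: edge_ideal_edge; apply: hw.
Qed.

(** Modulo the pulled-back ideal the variables outside G act by zero, and what
    remains is the quotient of the polynomial ring of G by its edge ideal. *)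
Lemma reg_pull_ideal : reg_quot pull_ideal = reg_quot IG.
Proof.
pose sG := enum 'I_#|G|.
(* The variables outside G come last, where they can be dropped one by one. *)
pose s1 := [seq enum_rank (f (enum_val i)) | i <- sG].
pose s := s1 ++ [seq j <- enum 'I_#|P| | j \notin s1].
have uG : uniq sG by apply: enum_uniq.
have sGT i : i \in sG by rewrite mem_enum.
have us : uniq s.
  rewrite cat_uniq map_inj_uniq // => [|i j /enum_rank_inj/f_inj/enum_val_inj //].
  rewrite uG filter_uniq ?enum_uniq // andbT /=.
  by apply/hasPn => j; rewrite mem_filter => /andP[].
have sT j : j \in s by rewrite mem_cat mem_filter mem_enum andbT orbN.
have sz1 : size s1 = size sG by rewrite size_map.
have var_in k : (k < size sG)%N -> restr (var K s k) = var K sG k.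
  move=> /(var_lt K)[i ei ->]; rewrite /var onth_cat sz1.
  have -> : (k < size sG)%N by rewrite -onthTE ei.
  by rewrite /s1 onth_map ei /= -/(vertex_var K _) restr_var vertex_var_val.
have var_out k : (size sG <= k)%N -> restr (var K s k) = 0.
  move=> kG.
  case: (ltnP k (size s)) => [/(var_lt K)[j ej ->]|]; last first.
    by rewrite -onthNE /var; case: (onth s k) => // _; apply: restr0.
  rewrite vertex_var_val; apply: restr_var0; apply/negP => /codomP[u eu].
  move: ej; rewrite onth_cat sz1 ltnNge kG /= => ej.
  have : j \in [seq j <- enum 'I_#|P| | j \notin s1] by apply/onthP; exists (k - size sG)%N.
  rewrite mem_filter => /andP[js1 _]; case/negP: js1.
  apply/mapP; exists (enum_rank u); first exact: sGT.
  by rewrite enum_rankK -eu enum_valK.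
have [gA gG] := (pull_ideal_graded, @edge_ideal_graded K G).
have tail t m : (forall i, vanish (size sG + m) (pull_ideal : poly_module K s -> Prop) i t) <->
    (forall i, vanish (size sG) (pull_ideal : poly_module K s -> Prop) i t).
  elim: m => [|m IH]; first by rewrite addn0.
  rewrite addnS -IH; apply: vanish_op_zero; first exact: graded_ideal_closed.
  move=> v; rewrite /= /pull_ideal restrM var_out ?leq_addr // mul0r.
  exact: gen_ideal0.
have swap t i : vanish (size sG) (pull_ideal : poly_module K s -> Prop) i t <->
    vanish (size sG) (IG : poly_module K sG -> Prop) i t.
  apply: (@vanish_iso (poly_module K s) (poly_module K sG) _ restr) => //.
  - split=> [|k v kG|z v]; [exact: restrA | by rewrite /= restrM var_in |].
    exact: restr_homog.
  - exact: graded_ideal_closed.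
  - move=> z v hv; exists (incl v); first exact: incl_homog.
    by rewrite inclK subrr; apply: gen_ideal0.
have le_iff r : reg_quot pull_ideal <= r <-> reg_quot IG <= r.
  rewrite (reg_quot_le gA r us sT) (reg_quot_le gG r uG sGT) size_cat sz1.
  split=> h t rt.
    by move=> i; apply/swap; apply: (proj1 (tail t _) (h t rt)).
  by apply/tail => i; apply/swap; apply: h.
by apply/le_anti/andP; split; apply/le_iff.
Qed.
End InducedSubgraph.

(** * The join of two graphs *)

Section Join.
Variables (K : fieldType) (G H : sgraph).
Local Notation P := (graph_prod G H).
Local Notation R := {mpoly K[#|P|]}.
Local Notation I := (@edge_ideal K P).
Local Notation fl := (inl : G -> P).
Local Notation fr := (inr : H -> P).
Local Notation A := (pull_ideal (K := K) fl).
Local Notation B := (pull_ideal (K := K) fr).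

Let inl_inj : injective fl. Proof. by move=> u v []. Qed.
Let inr_inj : injective fr. Proof. by move=> u v []. Qed.

Let inlE (u v : G) : edge (inl u : P) (inl v) = edge u v. Proof. by []. Qed.
Let inrE (u v : H) : edge (inr u : P) (inr v) = edge u v. Proof. by []. Qed.

Let not_inl (w : H) : (inr w : P) \notin codom fl.
Proof. by apply/negP => /codomP[]. Qed.

Let not_inr (u : G) : (inl u : P) \notin codom fr.
Proof. by apply/negP => /codomP[]. Qed.

Let restr_incl (p : {mpoly K[#|G|]}) :
  restr (K := K) fr (incl fl p) = (p@_0%MM)%:MP.
Proof.
elim/mpoly_ind: p => [c|i|p q hp hq|p q hp hq].
- by rewrite inclC restrC mcoeffC eqxx mulr1.
- rewrite mcoeffX mnm1_eq0 mpolyC0 vertex_var_val incl_var; exact: restr_var0.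
- by rewrite inclD restrD hp hq mcoeffD mpolyCD.
- by rewrite inclM restrM hp hq mcoeff0M mpolyCM.
Qed.

(** Up to mixed monomials, which lie in the edge ideal of the join, a polynomial
    is the sum of its restrictions to the two sides less the constant term that
    both of them contain. *)
Lemma join_split (p : R) :
  I (p - incl fl (restr fl p)
     - incl fr (restr fr p) + (p@_0%MM)%:MP).
Proof.
elim/mpoly_indX: p => [c|c p hp|p q hp hq|i p _].
- rewrite !restrC !inclC mcoeffC eqxx mulr1 subrr sub0r addNr.
  exact: gen_ideal0.
- rewrite !restrM !restrC !inclM !inclC mcoeff0M mcoeffC eqxx mulr1 mpolyCM.
  rewrite -!mulrBr -mulrDr; exact: gen_idealM.
- rewrite !restrD !inclD mcoeffD mpolyCD.
  have regroup (x y a b c d u v : R) :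
    x + y - (a + c) - (b + d) + (u + v) = (x - a - b + u) + (y - c - d + v) by ring.
  rewrite regroup; exact: (gen_idealD hp hq).
rewrite mcoeff0M mcoeffX mnm1_eq0 mul0r mpolyC0 addr0.
rewrite !restrM !inclM vertex_var_val.
case: (enum_val i) => [u|w].
  rewrite restr_var // incl_var [restr fr _]restr_var0 // incl0 mul0r subr0 -mulrBr.
  by apply: cone_vertex_mul => // -[v|v] //=; rewrite codom_f.
rewrite restr_var // incl_var [restr fl _]restr_var0 // incl0 mul0r subr0 -mulrBr.
by apply: cone_vertex_mul => // -[v|v] //=; rewrite codom_f.
Qed.

Lemma join_idealP (p : R) : I p <-> A p /\ B p.
Proof.
split=> [Ip|[Ap Bp]].
  by split; apply: edge_ideal_pull.
have := join_split p; rewrite (gi_const (pull_ideal_graded K fl) Ap).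
rewrite mpolyC0 addr0 => h.
have := gen_idealD h (incl_edge_ideal inrE Bp).
rewrite subrK => {}h; have := gen_idealD h (incl_edge_ideal inlE Ap).
by rewrite subrK.
Qed.

(** The sum of the two pulled-back ideals is the ideal of the variables, so the
    third term of the Mayer-Vietoris sequence is the residue field. Its homology
    has coefficient degree 0 and interferes only with bounds below 1. *)
Lemma reg_join_le r : 1 <= r ->
  reg_quot I <= r <-> reg_quot A <= r /\ reg_quot B <= r.
Proof.
move=> r1; have us : uniq (enum 'I_#|P|) by apply: enum_uniq.
have sT i : i \in enum 'I_#|P| by rewrite mem_enum.
have gI := @edge_ideal_graded K P.
have gA := pull_ideal_graded K fl.
have gB := pull_ideal_graded K fr.
rewrite (reg_quot_le gI r us sT) (reg_quot_le gA r us sT) (reg_quot_le gB r us sT).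
move: (enum _) => s in us sT *.
pose M := poly_module K s; pose e (p : M) : M := incl fl (restr fl p).
have eA : zmorph e by move=> p q; rewrite /e restrA inclA.
have eh t (v : M) : hom t v -> hom t (e v).
  by move=> hv; apply: incl_homog; apply: restr_homog.
have Ae (v : M) : A (v - e v).
  rewrite /pull_ideal restrA inclK // subrr; exact: gen_ideal0.
have Be t (v : M) : 0 < t -> hom t v -> B (e v).
  move=> t0 hv; rewrite /pull_ideal restr_incl mcoeff0_restr.
  by rewrite (homog_coeff0 hv) ?mdeg0 ?mpolyC0; [exact: gen_ideal0 | lia].
have Ac := graded_ideal_closed s gA; have Bc := graded_ideal_closed s gB.
have IAB i t := @vanish_eq M (size s) I (fun v => A v /\ B v) i t join_idealP.
have IBA i t : vanish (size s) (I : M -> Prop) i t <->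
    vanish (size s) (fun v : M => B v /\ A v) i t.
  by apply: vanish_eq => v; rewrite join_idealP; tauto.
split=> [h|[hA hB] t rt i].
  split=> t rt i; have t0 : 0 < t by lia.
    by apply: (@vanish_cap_left M (size s) A B e) => //; apply/IAB; apply: h.
  pose e' (v : M) := v - e v.
  apply: (@vanish_cap_left M (size s) B A e') => //.
  - by move=> u v; rewrite /e' eA !opprB addrACA [RHS]addrACA [- v - _]addrC.
  - by move=> z v hv; apply: (subgroupB (homog_sub _ _ _)) => //; apply: eh.
  - by move=> z v z0 hv; rewrite /e' subKr; apply: Be hv.
  - by move=> z v _ _; apply: Ae.
  - by apply/IBA; apply: h.
have t1 : 1 < t by lia.
by apply/IAB; apply: (@vanish_cap M (size s) A B e) => //; [exact: hA | exact: hB].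
Qed.
End Join.

Lemma reg_quot_ext (K : fieldType) n (I J : {mpoly K[n]} -> Prop) :
  graded_ideal I -> graded_ideal J -> (forall p, I p <-> J p) ->
  reg_quot I = reg_quot J.
Proof.
move=> gI gJ IJ; have us : uniq (enum 'I_n) by apply: enum_uniq.
have sT i : i \in enum 'I_n by rewrite mem_enum.
have le_iff r : reg_quot I <= r <-> reg_quot J <= r.
  rewrite (reg_quot_le gI r us sT) (reg_quot_le gJ r us sT).
  have e i t := @vanish_eq (poly_module K (enum 'I_n)) (size (enum 'I_n)) I J i t IJ.
  by split=> h t rt i; apply/e; apply: h.
by apply/le_anti/andP; split; apply/le_iff.
Qed.

Lemma reg_no_vertex (K : fieldType) (G : sgraph) : #|G| = 0%N ->
  reg_quot (@edge_ideal K G) = 0.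
Proof.
move=> G0; have gG := @edge_ideal_graded K G.
apply/le_anti/andP; split; last exact: reg_quot_ge0.
have us : uniq (enum 'I_#|G|) by apply: enum_uniq.
have sT i : i \in enum 'I_#|G| by rewrite mem_enum.
apply/(reg_quot_le gG _ us sT) => t t0 i c hc _.
have -> : c = 0.
  apply: (@kin_all0 _ _ i); apply: kin_imp hc => p hp.
  rewrite (nvar0_mpolyC_eq p G0) (homog_coeff0 hp) ?mpolyC0 // mdeg0; lia.
exists 0; split; first exact: (subgroup0 (kin_sub _ _ (homog_sub _ _ _))).
rewrite kdiff0 subrr; exact: (subgroup0 (kin_sub _ _ (graded_ideal_closed _ gG).1)).
Qed.

(** A restriction to an empty subgraph is the constant term. *)
Lemma pull_ideal_no_vertex (K : fieldType) (G P : sgraph) (f : G -> P) p :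
  #|G| = 0%N -> p@_0%MM = 0 -> pull_ideal (K := K) f p.
Proof.
move=> G0 p0; rewrite /pull_ideal (nvar0_mpolyC_eq (restr f p) G0) mcoeff0_restr p0.
by rewrite mpolyC0; apply: gen_ideal0.
Qed.

(* The hypothesis excludes exactly the case where both graphs are edgeless and
   both have a vertex; G*H is then complete bipartite, the left-hand side is 1
   and the right-hand side is 0. *)
Theorem proposition1p1 (K : fieldType) (G H : sgraph)
    (hGH : (exists u v : G, edge u v) \/ (exists u v : H, edge u v) \/
           #|G| = 0%N \/ #|H| = 0%N) :
  reg_quot (@edge_ideal K (graph_prod G H)) =
  Order.max (reg_quot (@edge_ideal K G)) (reg_quot (@edge_ideal K H)).
Proof.
have fl_inj : injective (inl : G -> graph_prod G H) by move=> u v [].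
have fr_inj : injective (inr : H -> graph_prod G H) by move=> u v [].
have gC := @edge_ideal_graded K (graph_prod G H).
have gA := pull_ideal_graded K (inl : G -> graph_prod G H).
have gB := pull_ideal_graded K (inr : H -> graph_prod G H).
have eA := reg_pull_ideal K fl_inj.
have eB := reg_pull_ideal K fr_inj.
have edge_case : 0 < reg_quot (@edge_ideal K (graph_prod G H)) ->
    0 < Order.max (reg_quot (@edge_ideal K G)) (reg_quot (@edge_ideal K H)) ->
    reg_quot (@edge_ideal K (graph_prod G H)) =
    Order.max (reg_quot (@edge_ideal K G)) (reg_quot (@edge_ideal K H)).
  move=> c0 m0.
  have le_iff r : 1 <= r -> reg_quot (@edge_ideal K (graph_prod G H)) <= r <->
      Order.max (reg_quot (@edge_ideal K G)) (reg_quot (@edge_ideal K H)) <= r.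
    move=> r1; rewrite (reg_join_le K G H r1) eA eB ge_max.
    by split=> [[-> ->]//|/andP].
  by apply/le_anti/andP; split; [apply/le_iff | apply/le_iff].
case: hGH => [[u [v uv]]|[[u [v uv]]|[G0|H0]]].
- apply: edge_case; first exact: (@reg_edge K (graph_prod G H) (inl u) (inl v)).
  by rewrite lt_max (reg_edge K uv).
- apply: edge_case; first exact: (@reg_edge K (graph_prod G H) (inr u) (inr v)).
  by rewrite lt_max (reg_edge K uv) orbT.
- rewrite (reg_no_vertex K G0) max_r ?reg_quot_ge0 //; last exact: edge_ideal_graded.
  rewrite -eB; apply: reg_quot_ext => // p; rewrite join_idealP.
  split=> [[]//|Bp]; split=> //; apply: pull_ideal_no_vertex => //.
  exact: (gi_const gB Bp).
- rewrite (reg_no_vertex K H0) max_l ?reg_quot_ge0 //; last exact: edge_ideal_graded.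
  rewrite -eA; apply: reg_quot_ext => // p; rewrite join_idealP.
  split=> [[]//|Ap]; split=> //; apply: pull_ideal_no_vertex => //.
  exact: (gi_const gA Ap).
Qed.
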